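(* Let $s>d/2$ be an integer, $\tilde f\in H^{s+3/2}(P(\Gamma))$ and $\tilde\xi\in H^{s+1}(P(\Gamma))$, and let $(\tilde u_n)_{n\ge0}$ be the solutions of the recursion below. Define $\tilde G_n(\tilde f)[\tilde\xi]$ recursively (with $\tilde u_{-1}=\tilde u_{-2}=0$, $\tilde G_{-1}=0$) by $$\tilde G_n(\tilde f)[\tilde\xi]=\partial_y\tilde u_n(\alpha,0)-(K^T\nabla_\alpha\tilde f)\cdot(K^T\nabla_\alpha\tilde u_{n-1}(\alpha,0))-\tfrac1a\tilde f\,\tilde G_{n-1}(\tilde f)[\tilde\xi]-\tfrac1a\tilde f(K^T\nabla_\alpha\tilde f)\cdot(K^T\nabla_\alpha\tilde u_{n-2}(\alpha,0))+|K^T\nabla_\alpha\tilde f|^2\partial_y\tilde u_{n-2}(\alpha,0).$$ Then there exist constants $C_0>0$ (depending only on $s,a,K,h,d$) and $K_2>0$ (depending on $\tilde\xi$, proportional to $\|\tilde\xi\|_{H^{s+1}}$) such that for every $B>C_0\|\tilde f\|_{H^{s+3/2}}$, $$\|\tilde G_n(\tilde f)[\tilde\xi]\|_{H^s}\le K_2B^n\quad\text{for all }n\ge0.$$ Consequently the series $\sum_{n\ge0}\tilde G_n(\tilde f)[\tilde\xi]\varepsilon^n$ converges in $H^s(P(\Gamma))$ for $|\varepsilon|<B^{-1}$. Recursion: $\tilde u_n$ solves (mode by mode) $\mathrm{div}_\alpha[KK^T\nabla_\alpha\tilde u_n]+\partial_y^2\tilde u_n=\mathrm{div}_\alpha[K\tilde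 F^\alpha_n]+\partial_y\tilde F^y_n+\tilde F^0_n$ on $(-a,0)$, $\tilde u_n(\alpha,0)=\delta_{n,0}\tilde\xi(\alpha)$, $\partial_y\tilde u_n(\alpha,-a)-\tilde T[\tilde u_n(\alpha,-a)]=\tilde J_n(\alpha)$, where $a^2\tilde F^\alpha_n=-2a\tilde f(K^T\nabla_\alpha\tilde u_{n-1})+a(a+y)(K^T\nabla_\alpha\tilde f)\partial_y\tilde u_{n-1}-\tilde f^2(K^T\nabla_\alpha\tilde u_{n-2})+(a+y)\tilde f(K^T\nabla_\alpha\tilde f)\partial_y\tilde u_{n-2}$, $a^2\tilde F^y_n=a(a+y)(K^T\nabla_\alpha\tilde f)\cdot(K^T\nabla_\alpha\tilde u_{n-1})+(a+y)\tilde f(K^T\nabla_\alpha\tilde f)\cdot(K^T\nabla_\alpha\tilde u_{n-2})-(a+y)^2|K^T\nabla_\alpha\tilde f|^2\partial_y\tilde u_{n-2}$, $a^2\tilde F^0_n=a(K^T\nabla_\alpha\tilde f)\cdot(K^T\nabla_\alpha\tilde u_{n-1})+\tilde f(K^T\nabla_\alpha\tilde f)\cdot(K^T\nabla_\alpha\tilde u_{n-2})-(a+y)|K^T\nabla_\alpha\tilde f|^2\partial_y\tilde u_{n-2}$, $a\tilde J_n=\tilde f\,\tilde T[\tilde u_{n-1}(\alpha,-a)]$.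
   Context: Let $n_0\ge 1$, $d>n_0$ be integers and $K\in\mathbb R^{d\times n_0}$ a matrix whose rows are linearly independent over $\mathbb Z$. $P(\Gamma)=[0,2\pi)^d$ is the torus; functions are expanded as $\tilde\xi(\alpha)=\sum_{p\in\mathbb Z^d}\hat\xi_pe^{ip\cdot\alpha}$, $\tilde u(\alpha,y)=\sum_p\hat u_p(y)e^{ip\cdot\alpha}$. With $\langle p\rangle=(1+|p|^2)^{1/2}$: $\|\tilde\xi\|_{H^s}^2=\sum_p\langle p\rangle^{2s}|\hat\xi_p|^2$; fix $a>0$, $\Omega=P(\Gamma)\times(-a,0)$, $\|\tilde u\|_{X^s}^2=\sum_p\langle p\rangle^{2s}\|\hat u_p\|_{L^2(-a,0)}^2$. $K^T\nabla_\alpha$ is the Fourier multiplier with symbol $iK^Tp\in\mathbb C^{n_0}$. Fix $h\in(a,\infty]$; $\tilde T$ is the Fourier multiplier with symbol $\tau(p)=|K^Tp|$ if $h=\infty$ and $\tau(p)=|K^Tp|\tanh((h-a)|K^Tp|)$ if $h<\infty$. The boundary value problem for $\tilde u_n$ is understood mode by mode: $\hat u_p''-|K^Tp|^2\hat u_p=(iK^Tp)\cdot\hat F^\alpha_p+\partial_y\hat F^y_p+\hat F^0_p$ on $(-a,0)$, $\hat u_p(0)=$ the $p$-th coefficient of the Dirichlet data, $\hat u_p'(-a)-\tau(p)\hat u_p(-a)=\hat J_p$. *)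

(* Defs.v *)
From Stdlib Require Import Reals List ZArith.
From Coquelicot Require Import Coquelicot.
Import ListNotations.
Open Scope R_scope.

Definition rsum (n : nat) (f : nat -> R) : R :=
  fold_right Rplus 0 (map f (seq 0 n)).
Definition csum (n : nat) (f : nat -> C) : C :=
  fold_right Cplus (RtoC 0) (map f (seq 0 n)).

(** * Lattice points of Z^d, represented as lists of length d *)
Definition zrange (N : nat) : list Z :=
  map (fun k => (Z.of_nat k - Z.of_nat N)%Z) (seq 0 (2 * N + 1)).
Fixpoint box (d N : nat) : list (list Z) :=
  match d with
  | O => [[]]
  | S d' => flat_map (fun z => map (cons z) (box d' N)) (zrange N)
  end.
Fixpoint zsub (p q : list Z) : list Z :=
  match p, q with
  | x :: p', y :: q' => (x - y)%Z :: zsub p' q'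
  | _, _ => []
  end.
Definition zopp (p : list Z) : list Z := map Z.opp p.
Definition zsq (p : list Z) : R := fold_right Rplus 0 (map (fun z => IZR z ^ 2) p).

Definition box_sumC (d N : nat) (g : list Z -> C) : C :=
  fold_right Cplus (RtoC 0) (map g (box d N)).
Definition box_sumR (d N : nat) (g : list Z -> R) : R :=
  fold_right Rplus 0 (map g (box d N)).

(* sum over p in Z^d (limit of the sums over the exhausting boxes [-N,N]^d;
   all sums occurring below are absolutely convergent in the paper) *)
Definition zsum (d : nat) (g : list Z -> C) : C :=
  (real (Lim_seq (fun N => fst (box_sumC d N g))),
   real (Lim_seq (fun N => snd (box_sumC d N g)))).

(** * Sobolev spaces H^r(P(Gamma)) via Fourier coefficients *)
Definition Hs_sq (d : nat) (r : R) (g : list Z -> C) : Rbar :=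
  Lim_seq (fun N => box_sumR d N (fun p => Rpower (1 + zsq p) r * Cmod (g p) ^ 2)).
Definition in_Hs (d : nat) (r : R) (g : list Z -> C) : Prop := is_finite (Hs_sq d r g).
Definition Hs_norm (d : nat) (r : R) (g : list Z -> C) : R := sqrt (real (Hs_sq d r g)).

(** * The matrix K (d x n0, entries K i j) and the symbols *)
Definition kt (d : nat) (K : nat -> nat -> R) (p : list Z) (j : nat) : R :=
  rsum d (fun i => K i j * IZR (nth i p 0%Z)).
(* symbol of K^T grad_alpha : i K^T p *)
Definition ik (d : nat) (K : nat -> nat -> R) (p : list Z) (j : nat) : C :=
  (0, kt d K p j).
Definition k2 (d n0 : nat) (K : nat -> nat -> R) (p : list Z) : R :=
  rsum n0 (fun j => kt d K p j ^ 2).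
Definition knorm (d n0 : nat) K p : R := sqrt (k2 d n0 K p).

Definition Zindep (d n0 : nat) (K : nat -> nat -> R) : Prop :=
  forall p : list Z, length p = d ->
    (forall j, (j < n0)%nat -> kt d K p j = 0) -> forall i, nth i p 0%Z = 0%Z.

Definition tanh (x : R) : R := (exp x - exp (- x)) / (exp x + exp (- x)).
(* symbol of T~ ; h = p_infty means h = infinity *)
Definition tau (d n0 : nat) K (a : R) (h : Rbar) (p : list Z) : R :=
  match h with
  | Finite hh => knorm d n0 K p * tanh ((hh - a) * knorm d n0 K p)
  | _ => knorm d n0 K p
  end.

Definition cdot (n0 : nat) (v w : nat -> C) : C := csum n0 (fun j => (v j * w j)%C).

(* real-valuedness of a function on the torus *)
Definition real_coeffs (d : nat) (g : list Z -> C) : Prop :=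
  forall p, length p = d -> g (zopp p) = Cconj (g p).

Definition has_deriv_in (lo hi : R) (g : R -> C) (y : R) (l : C) : Prop :=
  forall eps, 0 < eps -> exists delta, 0 < delta /\
    forall t, lo <= t <= hi -> Rabs (t - y) < delta ->
      Cmod (g t - g y - RtoC (t - y) * l)%C <= eps * Rabs (t - y).

(** * Fourier coefficients of the products occurring in the recursion *)
Section Coeffs.
Variables (d n0 : nat) (K : nat -> nat -> R) (a : R) (h : Rbar) (fh : list Z -> C).

Definition fsq (m : list Z) : C := zsum d (fun q => fh (zsub m q) * fh q)%C.
Definition gradf2 (m : list Z) : C :=
  zsum d (fun q => cdot n0 (ik d K (zsub m q)) (ik d K q) * fh (zsub m q) * fh q)%C.
Definition fgradf (m : list Z) (j : nat) : C :=
  zsum d (fun r => fh (zsub m r) * (ik d K r j * fh r))%C.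

(* U1, dU1 = u_{n-1}, d_y u_{n-1};  U2, dU2 = u_{n-2}, d_y u_{n-2} (mode functions) *)
Variables (U1 dU1 U2 dU2 : list Z -> R -> C).

Definition Falpha (p : list Z) (y : R) (j : nat) : C :=
  (RtoC (/ a ^ 2) *
   (RtoC (- (2 * a)) * zsum d (fun q => fh (zsub p q) * ik d K q j * U1 q y)
    + RtoC (a * (a + y)) * zsum d (fun q => ik d K (zsub p q) j * fh (zsub p q) * dU1 q y)
    - zsum d (fun q => fsq (zsub p q) * ik d K q j * U2 q y)
    + RtoC (a + y) * zsum d (fun q => fgradf (zsub p q) j * dU2 q y)))%C.

Definition Fy (p : list Z) (y : R) : C :=
  (RtoC (/ a ^ 2) *
   (RtoC (a * (a + y)) *
      zsum d (fun q => cdot n0 (ik d K (zsub p q)) (ik d K q) * fh (zsub p q) * U1 q y)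
    + RtoC (a + y) * zsum d (fun q => cdot n0 (fgradf (zsub p q)) (ik d K q) * U2 q y)
    - RtoC ((a + y) ^ 2) * zsum d (fun q => gradf2 (zsub p q) * dU2 q y)))%C.

Definition F0 (p : list Z) (y : R) : C :=
  (RtoC (/ a ^ 2) *
   (RtoC a *
      zsum d (fun q => cdot n0 (ik d K (zsub p q)) (ik d K q) * fh (zsub p q) * U1 q y)
    + zsum d (fun q => cdot n0 (fgradf (zsub p q)) (ik d K q) * U2 q y)
    - RtoC (a + y) * zsum d (fun q => gradf2 (zsub p q) * dU2 q y)))%C.

Definition Jn (p : list Z) : C :=
  (RtoC (/ a) * zsum d (fun q => fh (zsub p q) * RtoC (tau d n0 K a h q) * U1 q (- a)))%C.

End Coeffs.

Definition zeroU : list Z -> R -> C := fun _ _ => RtoC 0.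
Definition sh1 (u : nat -> list Z -> R -> C) (n : nat) : list Z -> R -> C :=
  match n with O => zeroU | S m => u m end.
Definition sh2 (u : nat -> list Z -> R -> C) (n : nat) : list Z -> R -> C :=
  match n with O | S O => zeroU | S (S m) => u m end.

(** * The recursion for (u_n): mode by mode, classical sense.
    u n p = hat u_{n,p}, du n p = its y-derivative on [-a,0]. *)
Definition solves_rec (d n0 : nat) (K : nat -> nat -> R) (a : R) (h : Rbar)
    (fh xih : list Z -> C) (u du : nat -> list Z -> R -> C) : Prop :=
  forall (n : nat) (p : list Z), length p = d ->
    (forall y, - a <= y <= 0 -> has_deriv_in (- a) 0 (u n p) y (du n p y)) /\
    (forall y, - a < y < 0 ->
       exists u2 l,
         has_deriv_in (- a) 0 (du n p) y u2 /\
         has_deriv_in (- a) 0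
           (Fy d n0 K a fh (sh1 u n) (sh2 u n) (sh2 du n) p) y l /\
         (u2 - RtoC (k2 d n0 K p) * u n p y =
          cdot n0 (ik d K p) (Falpha d K a fh (sh1 u n) (sh1 du n) (sh2 u n) (sh2 du n) p y)
          + l + F0 d n0 K a fh (sh1 u n) (sh2 u n) (sh2 du n) p y)%C) /\
    u n p 0 = (match n with O => xih p | S _ => RtoC 0 end) /\
    (du n p (-a)%R - RtoC (tau d n0 K a h p) * u n p (-a)%R =
       Jn d n0 K a h fh (sh1 u n) p)%C.

Definition Gstep (d n0 : nat) (K : nat -> nat -> R) (a : R) (fh : list Z -> C)
    (u du : nat -> list Z -> R -> C) (n : nat) (Gprev : list Z -> C) (p : list Z) : C :=
  (du n p 0
   - zsum d (fun q => cdot n0 (ik d K (zsub p q)) (ik d K q) * fh (zsub p q) * sh1 u n q 0)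
   - RtoC (/ a) * zsum d (fun q => fh (zsub p q) * Gprev q)
   - RtoC (/ a) * zsum d (fun q => cdot n0 (fgradf d K fh (zsub p q)) (ik d K q) * sh2 u n q 0)
   + zsum d (fun q => gradf2 d n0 K fh (zsub p q) * sh2 du n q 0))%C.

Fixpoint Gn (d n0 : nat) (K : nat -> nat -> R) (a : R) (fh : list Z -> C)
    (u du : nat -> list Z -> R -> C) (n : nat) : list Z -> C :=
  match n with
  | O => Gstep d n0 K a fh u du O (fun _ => RtoC 0)
  | S m => Gstep d n0 K a fh u du (S m) (Gn d n0 K a fh u du m)
  end.

Definition Gpsum (d n0 : nat) K a fh u du (eps : R) (N : nat) : list Z -> C :=
  fun p => csum (S N) (fun n => (RtoC (eps ^ n) * Gn d n0 K a fh u du n p)%C).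

(* Main.v *)
Require Import Defs.
From Stdlib Require Import Reals List ZArith Lra Lia.
From Coquelicot Require Import Coquelicot.
Import ListNotations.
Open Scope R_scope.

(** Each Fourier mode is measured by the sup norm in [y] of [du] and of [k u], with
    [k = |K^T p|], and the modes are summed in weighted [l^2].  Writing [w = du - F^y], the
    boundary value problem is diagonalised by [w + k u] and [w - k u], which are damped
    backwards and forwards; this bounds [sup |du|] and [sup k |u|] by
    [k |u(0)| + |J| + sup |F^alpha| + sup |F^y| + sup |F^0|] uniformly in [k >= 0].  Every source term is a
    convolution of [f] or [K^T grad f] with [K^T grad u] or [du] of earlier index, and the
    weighted [l^2] space is a convolution algebra for [s > d / 2].  Hence the norms [m_n] of
    the majorants satisfy [m_n <= theta m_(n-1) + theta^2 m_(n-2)] with [theta]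
    proportional to [|f|], which gives geometric growth, and the boundary values [du(0)]
    entering [G_n] are controlled by the same sup norms. *)

(** Since [d > n0], the vectors [K^T p] come arbitrarily close to [0] for nonzero [p]. Hence no
    estimate may divide by [k], and [|u|] has no bound by a fixed multiple of [k |u|]. The scheme
    closes because [u] enters the sources, the Robin datum and [G_n] only through [K^T grad u],
    [T~ u] and [du], all dominated by [k |u|] and [|du|]. Taking suprema in [y] instead of
    [L^2(-a,0)] norms makes the traces at [0] and [-a] available at no cost. Moreover
    [F^y = (a + y) F^0] vanishes at [y = -a], so that replacing [du] by [w] leaves the Robin datum
    unchanged. The size of [f] is never restricted: the rate [B] is taken to be at least [4 theta],
    after which the two terms of the recursion contribute at most the fractions [1/4] and [1/16]. *)

Definition lsum {A : Type} (l : list A) (f : A -> R) : R :=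
  fold_right Rplus 0 (map f l).

(** * Finite sums over lists *)

Section ListSums.
Context {A : Type}.
Implicit Types (l : list A) (f g : A -> R).

Lemma lsum_le l f g : (forall x, In x l -> f x <= g x) -> lsum l f <= lsum l g.
Proof.
  induction l as [|x l IH]; intros H; unfold lsum in *; simpl in *; [lra|].
  apply Rplus_le_compat; auto.
Qed.

Lemma lsum_ext l f g : (forall x, In x l -> f x = g x) -> lsum l f = lsum l g.
Proof.
  intros H; apply Rle_antisym; apply lsum_le; intros x Hx; rewrite (H x Hx); lra.
Qed.

Lemma lsum_zero l : lsum l (fun _ => 0) = 0.
Proof. induction l as [|x l IH]; unfold lsum in *; simpl in *; lra. Qed.

Lemma lsum_nonneg l f : (forall x, In x l -> 0 <= f x) -> 0 <= lsum l f.
Proof. intros H; rewrite <- (lsum_zero l); now apply lsum_le. Qed.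

Lemma lsum_plus l f g : lsum l (fun x => f x + g x) = lsum l f + lsum l g.
Proof. induction l as [|x l IH]; unfold lsum in *; simpl in *; lra. Qed.

Lemma lsum_scal l c f : lsum l (fun x => c * f x) = c * lsum l f.
Proof. induction l as [|x l IH]; unfold lsum in *; simpl in *; lra. Qed.

Lemma lsum_const l c : lsum l (fun _ => c) = INR (length l) * c.
Proof.
  induction l as [|x l IH]; unfold lsum in *; cbn [map fold_right length].
  - simpl; lra.
  - rewrite IH, S_INR; lra.
Qed.

Lemma lsum_app l1 l2 f : lsum (l1 ++ l2) f = lsum l1 f + lsum l2 f.
Proof. induction l1 as [|x l IH]; unfold lsum in *; simpl in *; lra. Qed.

Lemma lsum_map {B : Type} (h : B -> A) (l : list B) f :
  lsum (map h l) f = lsum l (fun x => f (h x)).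
Proof. unfold lsum; now rewrite map_map. Qed.

Lemma lsum_swap {B : Type} l (l' : list B) (F : A -> B -> R) :
  lsum l (fun x => lsum l' (F x)) = lsum l' (fun y => lsum l (fun x => F x y)).
Proof.
  induction l as [|x l IH]; unfold lsum in *; simpl in *.
  - induction l'; simpl; lra.
  - rewrite IH; clear IH; induction l' as [|y l' IH']; simpl in *; lra.
Qed.

Lemma lsum_in l f x : (forall y, In y l -> 0 <= f y) -> In x l -> f x <= lsum l f.
Proof.
  induction l as [|y l IH]; intros H Hx; [destruct Hx|].
  assert (0 <= lsum l f) by (apply lsum_nonneg; intros; apply H; now right).
  change (f x <= f y + lsum l f).
  destruct Hx as [->|Hx]; [lra|].
  assert (f x <= lsum l f) by (apply IH; auto; intros; apply H; now right).
  assert (0 <= f y) by (apply H; now left). lra.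
Qed.

(** Replaces a change of variables: an injective image of a box is a duplicate-free list contained
    in a larger box, and nonnegativity turns the inclusion into an inequality. *)
Lemma lsum_incl l l' f : NoDup l -> incl l l' -> (forall x, In x l' -> 0 <= f x) ->
  lsum l f <= lsum l' f.
Proof.
  revert l'; induction l as [|x l IH]; intros l' Hn Hi H.
  - now apply lsum_nonneg.
  - destruct (in_split x l') as [l1 [l2 ->]]; [apply Hi; now left|].
    inversion Hn as [|? ? Hx Hl]; subst.
    assert (E : lsum l f <= lsum (l1 ++ l2) f).
    { apply IH; auto.
      - intros y Hy. assert (Hy' : In y (l1 ++ x :: l2)) by (apply Hi; now right).
        apply in_app_or in Hy'; apply in_or_app.
        destruct Hy' as [?|[->|?]]; auto; contradiction.
      - intros y Hy; apply H; apply in_app_or in Hy; apply in_or_app; simpl; tauto. }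
    rewrite lsum_app in *.
    change (f x + lsum l f <= lsum l1 f + (f x + lsum l2 f)); lra.
Qed.

Lemma lsum_cauchy_schwarz l f g :
  lsum l (fun x => f x * g x) ^ 2 <= lsum l (fun x => f x ^ 2) * lsum l (fun x => g x ^ 2).
Proof.
  induction l as [|x l IH]; [unfold lsum; simpl; lra|].
  change (lsum (x :: l) (fun x => f x * g x)) with (f x * g x + lsum l (fun x => f x * g x)).
  change (lsum (x :: l) (fun x => f x ^ 2)) with (f x ^ 2 + lsum l (fun x => f x ^ 2)).
  change (lsum (x :: l) (fun x => g x ^ 2)) with (g x ^ 2 + lsum l (fun x => g x ^ 2)).
  assert (HF : 0 <= lsum l (fun x => f x ^ 2)) by (apply lsum_nonneg; intros; apply pow2_ge_0).
  assert (HG : 0 <= lsum l (fun x => g x ^ 2)) by (apply lsum_nonneg; intros; apply pow2_ge_0).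
  revert IH HF HG.
  generalize (lsum l (fun x => f x * g x)) (lsum l (fun x => f x ^ 2))
    (lsum l (fun x => g x ^ 2)) (f x) (g x).
  intros P F G u v IH HF HG.
  assert (HP : Rabs P <= sqrt F * sqrt G).
  { rewrite <- sqrt_mult by assumption.
    rewrite <- (sqrt_Rsqr_abs P). apply sqrt_le_1_alt. unfold Rsqr; lra. }
  (* The arithmetic-geometric mean inequality for [|u| sqrt G] and [|v| sqrt F], combined with
     [|P| <= sqrt F sqrt G] from the induction hypothesis. *)
  assert (2 * u * v * P <= u ^ 2 * G + v ^ 2 * F).
  { pose proof (sqrt_pos F); pose proof (sqrt_pos G).
    rewrite <- (sqrt_sqrt F) by assumption; rewrite <- (sqrt_sqrt G) by assumption.
    assert (u * v * P <= Rabs u * Rabs v * (sqrt F * sqrt G)).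
    { apply Rle_trans with (Rabs (u * v * P)); [apply Rle_abs|].
      rewrite !Rabs_mult. apply Rmult_le_compat_l; auto.
      apply Rmult_le_pos; apply Rabs_pos. }
    rewrite <- (pow2_abs u), <- (pow2_abs v).
    pose proof (pow2_ge_0 (Rabs u * sqrt G - Rabs v * sqrt F)). nra. }
  nra.
Qed.

Lemma lsum_minkowski l f g m1 m2 : 0 <= m1 -> 0 <= m2 ->
  lsum l (fun x => f x ^ 2) <= m1 ^ 2 -> lsum l (fun x => g x ^ 2) <= m2 ^ 2 ->
  lsum l (fun x => (f x + g x) ^ 2) <= (m1 + m2) ^ 2.
Proof.
  intros H1 H2 Hf Hg.
  rewrite (lsum_ext _ _ (fun x => f x ^ 2 + (2 * (f x * g x) + g x ^ 2)))
    by (intros; ring).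
  rewrite lsum_plus, lsum_plus, lsum_scal.
  pose proof (lsum_cauchy_schwarz l f g) as CS.
  assert (HF : 0 <= lsum l (fun x => f x ^ 2)) by (apply lsum_nonneg; intros; apply pow2_ge_0).
  assert (HG : 0 <= lsum l (fun x => g x ^ 2)) by (apply lsum_nonneg; intros; apply pow2_ge_0).
  assert (lsum l (fun x => f x * g x) <= m1 * m2).
  { apply Rnot_lt_le; intro Hlt.
    assert (0 <= m1 * m2) by now apply Rmult_le_pos.
    assert (lsum l (fun x => f x ^ 2) * lsum l (fun x => g x ^ 2) <= m1 ^ 2 * m2 ^ 2)
      by now apply Rmult_le_compat.
    nra. }
  nra.
Qed.

Lemma is_lim_seq_lsum l (F : nat -> A -> R) (f : A -> R) :
  (forall x, In x l -> is_lim_seq (fun n => F n x) (f x)) ->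
  is_lim_seq (fun n => lsum l (F n)) (lsum l f).
Proof.
  induction l as [|x l IH]; intros H; [apply is_lim_seq_const|].
  apply (is_lim_seq_plus' (fun n => F n x) (fun n => lsum l (F n))).
  - apply H; now left.
  - apply IH; intros; apply H; now right.
Qed.

End ListSums.

Lemma lsum_flat_map {A B : Type} (h : B -> list A) (l : list B) (f : A -> R) :
  lsum (flat_map h l) f = lsum l (fun x => lsum (h x) f).
Proof.
  induction l as [|x l IH]; [reflexivity|].
  simpl flat_map; rewrite lsum_app, IH; reflexivity.
Qed.

Lemma NoDup_map_in {A B : Type} (f : A -> B) l :
  (forall x y, In x l -> In y l -> f x = f y -> x = y) -> NoDup l -> NoDup (map f l).
Proof.
  intros Hf Hl; induction Hl as [|x l Hx Hl IH]; simpl; constructor.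
  - rewrite in_map_iff; intros [y [E Hy]].
    rewrite (Hf x y) in Hx; simpl; auto.
  - apply IH; intros; apply Hf; simpl; auto.
Qed.

Lemma NoDup_flat_map_disjoint {A B : Type} (h : A -> list B) (l : list A) :
  NoDup l -> (forall x, In x l -> NoDup (h x)) ->
  (forall x y b, In b (h x) -> In b (h y) -> x = y) -> NoDup (flat_map h l).
Proof.
  intros Hl Hh Hd; induction Hl as [|x l Hx Hl IH]; simpl; [constructor|].
  apply NoDup_app; [apply Hh; now left| |].
  - apply IH; intros; apply Hh; now right.
  - intros b Hb Hb'; apply in_flat_map in Hb' as [y [Hy Hb']].
    rewrite (Hd x y b Hb Hb') in Hx; contradiction.
Qed.

(** * Boxes in the lattice *)

Lemma In_zrange N z : In z (zrange N) <-> (Z.abs z <= Z.of_nat N)%Z.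
Proof.
  unfold zrange; rewrite in_map_iff; split.
  - intros [k [<- Hk]]; apply in_seq in Hk; lia.
  - intros H; exists (Z.to_nat (z + Z.of_nat N)); rewrite in_seq; lia.
Qed.

Lemma NoDup_zrange N : NoDup (zrange N).
Proof.
  apply NoDup_map_in; [intros x y; lia|apply seq_NoDup].
Qed.

Lemma In_box d N p :
  In p (box d N) <-> length p = d /\ List.Forall (fun z => (Z.abs z <= Z.of_nat N)%Z) p.
Proof.
  revert p; induction d as [|d IH]; intros p; simpl.
  - split; [intros [<-|[]]; auto|].
    intros [H _]; left; symmetry; apply length_zero_iff_nil, H.
  - rewrite in_flat_map; split.
    + intros [z [Hz Hp]]; apply in_map_iff in Hp as [q [<- Hq]].
      apply IH in Hq as [Hl Hq]; apply In_zrange in Hz; simpl; auto.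
    + intros [Hl Hp]; destruct p as [|z p]; [discriminate|].
      inversion Hp; subst. exists z; split; [now apply In_zrange|].
      apply in_map, IH; split; auto.
Qed.

Lemma box_length d N p : In p (box d N) -> length p = d.
Proof. intros H; now apply In_box in H. Qed.

Lemma NoDup_box d N : NoDup (box d N).
Proof.
  induction d as [|d IH]; simpl; [repeat constructor; auto|].
  apply NoDup_flat_map_disjoint.
  - apply NoDup_zrange.
  - intros z _; apply NoDup_map_in; [intros x y; congruence|assumption].
  - intros x y b Hx Hy; apply in_map_iff in Hx as [q [<- _]].
    apply in_map_iff in Hy as [r [E _]]; congruence.
Qed.

Lemma box_incl d N M : (N <= M)%nat -> incl (box d N) (box d M).
Proof.
  intros H p Hp; apply In_box in Hp as [Hl Hp]; apply In_box; split; auto.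
  revert Hp; apply List.Forall_impl; lia.
Qed.

Lemma exists_box d p : length p = d -> exists N, In p (box d N).
Proof.
  intros Hl; exists (Z.to_nat (fold_right Z.max 0%Z (map Z.abs p))).
  apply In_box; split; auto; clear Hl.
  rewrite Z2Nat.id.
  2: { induction p; simpl; lia. }
  induction p as [|z p IH]; constructor; simpl; [lia|].
  revert IH; apply List.Forall_impl; intros; lia.
Qed.

Lemma length_zsub p q : length p = length q -> length (zsub p q) = length p.
Proof.
  revert q; induction p as [|z p IH]; intros [|w q]; simpl; auto; try discriminate.
Qed.

Lemma length_zsub_eq d p q : length p = d -> length q = d -> length (zsub p q) = d.
Proof. intros Hp Hq; rewrite length_zsub; congruence. Qed.

Lemma zsub_box d N M p q : In p (box d N) -> In q (box d M) -> In (zsub p q) (box d (N + M)).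
Proof.
  rewrite !In_box; intros [Hp HN] [Hq HM]; split; [now apply length_zsub_eq|].
  revert q Hq HM; subst d; induction HN as [|z p Hz HN IH]; intros [|w q]; simpl;
    try discriminate; intros Hq HM; constructor; inversion HM; subst; [lia|].
  apply IH; auto.
Qed.

Lemma zsub_inj_r p q q' : length q = length p -> length q' = length p ->
  zsub p q = zsub p q' -> q = q'.
Proof.
  revert q q'; induction p as [|z p IH]; intros [|w q] [|w' q']; simpl; try discriminate; auto.
  intros H H' E; inversion E; f_equal; [lia|]. apply IH; auto.
Qed.

Lemma zsub_inj_l q p p' : length p = length q -> length p' = length q ->
  zsub p q = zsub p' q -> p = p'.
Proof.
  revert p p'; induction q as [|z q IH]; intros [|w p] [|w' p']; simpl; try discriminate; auto.
  intros H H' E; inversion E; f_equal; [lia|]. apply IH; auto.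
Qed.

(** A box is not invariant under [q -> p - q], but its image lies in the box of radius [N + M]. The
    enlargement is harmless because the bounds applied to the right-hand side are uniform in the
    radius. *)
Lemma lsum_box_shift_r d N M p f : In p (box d N) -> (forall q, length q = d -> 0 <= f q) ->
  lsum (box d M) (fun q => f (zsub p q)) <= lsum (box d (N + M)) f.
Proof.
  intros Hp Hf. rewrite <- (lsum_map (zsub p) (box d M) f).
  apply lsum_incl.
  - apply NoDup_map_in; [|apply NoDup_box]; intros x y Hx Hy.
    apply box_length in Hx, Hy, Hp; apply zsub_inj_r; congruence.
  - intros r Hr; apply in_map_iff in Hr as [q [<- Hq]]; now apply zsub_box.
  - intros r Hr; apply Hf; now apply box_length in Hr.
Qed.

Lemma lsum_box_shift_l d N M q f : In q (box d M) -> (forall p, length p = d -> 0 <= f p) ->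
  lsum (box d N) (fun p => f (zsub p q)) <= lsum (box d (N + M)) f.
Proof.
  intros Hq Hf. rewrite <- (lsum_map (fun p => zsub p q) (box d N) f).
  apply lsum_incl.
  - apply NoDup_map_in; [|apply NoDup_box]; intros x y Hx Hy.
    apply box_length in Hx, Hy, Hq; apply zsub_inj_l; congruence.
  - intros r Hr; apply in_map_iff in Hr as [p [<- Hp]]; now apply zsub_box.
  - intros r Hr; apply Hf; now apply box_length in Hr.
Qed.

Lemma lsum_box_mono d N M f : (N <= M)%nat -> (forall q, length q = d -> 0 <= f q) ->
  lsum (box d N) f <= lsum (box d M) f.
Proof.
  intros H Hf; apply lsum_incl; [apply NoDup_box|now apply box_incl|].
  intros p Hp; apply Hf; now apply box_length in Hp.
Qed.

(** * Convergence of the sum of the weights *)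

Definition zl1 (p : list Z) : R := fold_right Rplus 0 (map (fun z => Rabs (IZR z)) p).

Lemma zl1_nonneg p : 0 <= zl1 p.
Proof. apply (lsum_nonneg p); intros; apply Rabs_pos. Qed.

Lemma zsq_nonneg p : 0 <= zsq p.
Proof. apply (lsum_nonneg p); intros; apply pow2_ge_0. Qed.

(** Cauchy-Schwarz for [(1, |p_1|, ..., |p_d|)] against the all-ones vector, by induction on the
    coordinates. The [l^1] form is wanted because it can be summed one coordinate at a time. *)
Lemma zl1_sq_le p : (1 + zl1 p) ^ 2 <= INR (S (length p)) * (1 + zsq p).
Proof.
  induction p as [|z p IH].
  - unfold zl1, zsq; simpl; lra.
  - change (zl1 (z :: p)) with (Rabs (IZR z) + zl1 p).
    change (zsq (z :: p)) with (IZR z ^ 2 + zsq p).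
    change (length (z :: p)) with (S (length p)).
    rewrite <- (pow2_abs (IZR z)).
    pose proof (Rabs_pos (IZR z)) as Hz; revert Hz; generalize (Rabs (IZR z)); intros t Ht.
    pose proof (zl1_nonneg p) as Hl; pose proof (zsq_nonneg p) as Hq.
    rewrite S_INR. revert IH Hl Hq.
    assert (HN : 1 <= INR (S (length p))) by (rewrite S_INR; pose proof (pos_INR (length p)); lra).
    revert HN; generalize (INR (S (length p))) (zl1 p) (zsq p); intros n l q Hn IH Hl Hq.
    set (x := 1 + l) in *.
    assert (n * (2 * t * x) <= n * (n * t ^ 2) + x ^ 2).
    { pose proof (pow2_ge_0 (n * t - x)); nra. }
    assert (n * (2 * t * x + x ^ 2) <= n * (n * t ^ 2 + (n + 1) * (1 + q))) by nra.
    assert (2 * t * x + x ^ 2 <= n * t ^ 2 + (n + 1) * (1 + q)).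
    { apply Rmult_le_reg_l with n; lra. }
    unfold x in *; nra.
Qed.

Lemma lsum_zrange_le N f : (forall z, 0 <= f z) ->
  lsum (zrange N) f <= f 0%Z
    + lsum (seq 1 N) (fun k => f (Z.of_nat k)) + lsum (seq 1 N) (fun k => f (- Z.of_nat k)%Z).
Proof.
  intros Hf.
  apply Rle_trans with (lsum (0%Z :: map Z.of_nat (seq 1 N)
                          ++ map (fun k => (- Z.of_nat k)%Z) (seq 1 N)) f).
  - apply lsum_incl; [apply NoDup_zrange| |auto].
    intros z Hz; apply In_zrange in Hz; simpl.
    destruct (Z.compare_spec z 0) as [->|Hlt|Hgt]; [auto| |].
    + right; apply in_or_app; right; apply in_map_iff; exists (Z.to_nat (- z)).
      rewrite in_seq; lia.
    + right; apply in_or_app; left; apply in_map_iff; exists (Z.to_nat z).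
      rewrite in_seq; lia.
  - change (f 0%Z + lsum (map Z.of_nat (seq 1 N)
              ++ map (fun k => (- Z.of_nat k)%Z) (seq 1 N)) f <= f 0%Z
    + lsum (seq 1 N) (fun k => f (Z.of_nat k)) + lsum (seq 1 N) (fun k => f (- Z.of_nat k)%Z)).
    rewrite lsum_app, !lsum_map; lra.
Qed.

(** Telescoping: each term is at most [1 / (x + k - 1) - 1 / (x + k)]. *)
Lemma lsum_inv_sq_le x N : 0 < x ->
  lsum (seq 1 N) (fun k => / (x + INR k) ^ 2) <= / x - / (x + INR N).
Proof.
  intros Hx; induction N as [|N IH].
  - unfold lsum; simpl; rewrite Rplus_0_r; lra.
  - rewrite seq_S, lsum_app.
    change (lsum [(1 + N)%nat] (fun k => / (x + INR k) ^ 2)) with (/ (x + INR (1 + N)) ^ 2 + 0).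
    change (1 + N)%nat with (S N); rewrite S_INR.
    pose proof (pos_INR N).
    assert (E : / (x + INR N) - / (x + (INR N + 1)) = / ((x + INR N) * (x + (INR N + 1))))
      by (field; lra).
    assert (/ (x + (INR N + 1)) ^ 2 <= / ((x + INR N) * (x + (INR N + 1)))).
    { apply Rinv_le_contravar; nra. }
    lra.
Qed.

(** Summing out one coordinate costs one power of [x]. After [x^-(m-2)] is pulled out, the remaining
    sum of inverse squares is at most [3 / x]: one [1 / x] from [z = 0] and one from each
    half-line. *)
Lemma lsum_inv_pow_le x m N : 1 <= x -> (2 <= m)%nat ->
  lsum (zrange N) (fun z => / (x + Rabs (IZR z)) ^ m) <= 3 * / x ^ (m - 1).
Proof.
  intros Hx Hm. destruct m as [|[|m]]; [lia|lia|].
  replace (S (S m) - 1)%nat with (S m) by lia.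
  apply Rle_trans with (lsum (zrange N) (fun z => / x ^ m * / (x + Rabs (IZR z)) ^ 2)).
  { apply lsum_le; intros z _. pose proof (Rabs_pos (IZR z)).
    rewrite <- Rinv_mult. apply Rinv_le_contravar.
    - apply Rmult_lt_0_compat; apply pow_lt; lra.
    - replace (S (S m)) with (m + 2)%nat by lia; rewrite pow_add.
      apply Rmult_le_compat_r; [apply pow_le; lra|].
      apply pow_incr; lra. }
  rewrite lsum_scal.
  apply Rle_trans with (/ x ^ m * (3 * / x)).
  - apply Rmult_le_compat_l; [left; apply Rinv_0_lt_compat, pow_lt; lra|].
    eapply Rle_trans; [apply lsum_zrange_le|].
    { intros z; left; apply Rinv_0_lt_compat, pow_lt; pose proof (Rabs_pos (IZR z)); lra. }
    rewrite (lsum_ext _ _ (fun k => / (x + INR k) ^ 2)).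
    2: { intros k _; rewrite <- INR_IZR_INZ, Rabs_pos_eq; auto; apply pos_INR. }
    rewrite (lsum_ext _ (fun k => / (x + Rabs (IZR (- Z.of_nat k))) ^ 2)
               (fun k => / (x + INR k) ^ 2)).
    2: { intros k _; rewrite opp_IZR, Rabs_Ropp, <- INR_IZR_INZ, Rabs_pos_eq; auto; apply pos_INR. }
    pose proof (lsum_inv_sq_le x N ltac:(lra)) as H.
    assert (0 < / (x + INR N)) by (apply Rinv_0_lt_compat; pose proof (pos_INR N); lra).
    rewrite Rabs_R0, Rplus_0_r.
    assert (/ x ^ 2 <= / x) by (apply Rinv_le_contravar; nra).
    lra.
  - simpl pow; rewrite Rinv_mult; lra.
Qed.

(** The base [x] is general so that the induction hypothesis can be used at [x + |z|], with [z] the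
    first coordinate. Each coordinate contributes a factor [3] and lowers the exponent by one. *)
Lemma lsum_box_inv_pow_le d : forall x m N, 1 <= x -> (d < m)%nat ->
  lsum (box d N) (fun q => / (x + zl1 q) ^ m) <= 3 ^ d * / x ^ (m - d).
Proof.
  induction d as [|d IH]; intros x m N Hx Hm.
  - unfold lsum, zl1; simpl. rewrite !Rplus_0_r, Nat.sub_0_r; lra.
  - simpl box; rewrite lsum_flat_map.
    apply Rle_trans with
      (lsum (zrange N) (fun z => 3 ^ d * / (x + Rabs (IZR z)) ^ (m - d))).
    + apply lsum_le; intros z _; rewrite lsum_map.
      rewrite (lsum_ext _ _ (fun q => / ((x + Rabs (IZR z)) + zl1 q) ^ m)).
      2: { intros q _; do 2 f_equal. unfold zl1; simpl; ring. }
      apply IH; [|lia]. pose proof (Rabs_pos (IZR z)); lra.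
    + rewrite lsum_scal.
      pose proof (lsum_inv_pow_le x (m - d) N Hx ltac:(lia)) as H.
      replace (m - d - 1)%nat with (m - S d)%nat in H by lia.
      simpl pow; rewrite (Rmult_comm 3), Rmult_assoc.
      apply Rmult_le_compat_l; [apply pow_le; lra|exact H].
Qed.

Definition weight_sum_bound (d s : nat) : R := INR (S d) ^ s * 3 ^ d.

Lemma weight_pos p s : 0 < (1 + zsq p) ^ s.
Proof. apply pow_lt; pose proof (zsq_nonneg p); lra. Qed.

(** Passing to the [l^1] weight costs [(d + 1)^s]; its exponent [2 s] exceeds [d], so the lattice
    sum at [x = 1] is at most [3^d]. *)
Lemma weight_sum_le d s N : (d < 2 * s)%nat ->
  lsum (box d N) (fun q => / (1 + zsq q) ^ s) <= weight_sum_bound d s.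
Proof.
  intros H.
  apply Rle_trans with (lsum (box d N) (fun q => INR (S d) ^ s * / (1 + zl1 q) ^ (2 * s))).
  - apply lsum_le; intros q Hq; apply box_length in Hq.
    pose proof (zl1_sq_le q) as Hl; rewrite Hq in Hl.
    assert (E : ((1 + zl1 q) ^ 2) ^ s <= (INR (S d) * (1 + zsq q)) ^ s).
    { apply pow_incr; split; [apply pow2_ge_0|exact Hl]. }
    rewrite <- pow_mult, Rpow_mult_distr in E.
    pose proof (weight_pos q s).
    assert (0 < (1 + zl1 q) ^ (2 * s)) by (apply pow_lt; pose proof (zl1_nonneg q); lra).
    apply (Rmult_le_reg_r ((1 + zsq q) ^ s * (1 + zl1 q) ^ (2 * s))).
    { now apply Rmult_lt_0_compat. }
    replace (/ (1 + zsq q) ^ s * ((1 + zsq q) ^ s * (1 + zl1 q) ^ (2 * s)))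
      with ((1 + zl1 q) ^ (2 * s)) by (field; lra).
    replace (INR (S d) ^ s * / (1 + zl1 q) ^ (2 * s) * ((1 + zsq q) ^ s * (1 + zl1 q) ^ (2 * s)))
      with (INR (S d) ^ s * (1 + zsq q) ^ s) by (field; lra).
    exact E.
  - rewrite lsum_scal. apply Rmult_le_compat_l; [apply pow_le, pos_INR|].
    eapply Rle_trans; [apply lsum_box_inv_pow_le; [apply Rle_refl|exact H]|].
    rewrite pow1, Rinv_1; lra.
Qed.

(** * A two-point boundary value problem *)

Lemma is_derive_nonneg_le (f df : R -> R) c b : c <= b ->
  (forall y, c <= y <= b -> is_derive f y (df y)) ->
  (forall y, c <= y <= b -> 0 <= df y) -> f c <= f b.
Proof.
  intros Hcb Hd Hp.
  destruct (MVT_gen f c b df) as [x [Hx E]].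
  - intros x Hx; apply Hd. rewrite Rmin_left, Rmax_right in Hx; lra.
  - intros x Hx; rewrite Rmin_left, Rmax_right in Hx by lra.
    apply continuity_pt_filterlim.
    apply (ex_derive_continuous f x); exists (df x); apply Hd; lra.
  - rewrite Rmin_left, Rmax_right in Hx by lra.
    assert (0 <= df x * (b - c)) by (apply Rmult_le_pos; [apply Hp|]; lra). lra.
Qed.

(* [v' = -k v + r] is damped, so a source of size [k P + D] costs only [P + (y - c) D],
   uniformly in [k >= 0]. *)
Lemma damped_ode_bound (v r : R -> R) c y k P D : 0 <= k -> 0 <= P -> 0 <= D -> c <= y ->
  (forall t, c <= t <= y -> is_derive v t (- k * v t + r t)) ->
  (forall t, c <= t <= y -> Rabs (r t) <= k * P + D) ->
  Rabs (v y - exp (- (k * (y - c))) * v c) <= P + (y - c) * D.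
Proof.
  intros Hk HP HD Hcy Hv Hr.
  set (E := fun t => exp (k * (t - c))).
  assert (HE : forall t, 0 < E t) by (intros; apply exp_pos).
  assert (HEd : forall t, is_derive E t (k * E t)).
  { intros t; unfold E; auto_derive; [exact I|]. unfold Rminus; ring. }
  (* With the integrating factor [E], the function [P E + D (t - c) E + sg E v] is nondecreasing:
     its derivative contains [E (k P + D + sg r)], which is nonnegative, and a further nonnegative
     term. The two signs give the two sides of the absolute value. *)
  assert (key : forall sg, (sg = 1 \/ sg = -1) ->
    P * E c + sg * (E c * v c) <= P * E y + D * (y - c) * E y + sg * (E y * v y)).
  { intros sg Hsg.
    pose proof (is_derive_nonneg_le
      (fun t => P * E t + D * (t - c) * E t + sg * (E t * v t))
      (fun t => P * (k * E t) + (D * E t + D * (t - c) * (k * E t)) + sg * (E t * r t)) c y Hcy) as H.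
    simpl in H. replace (D * (c - c)) with 0 in H by ring.
    rewrite Rmult_0_l, Rplus_0_r in H. apply H; clear H.
    - intros t Ht. specialize (Hv t Ht). specialize (HEd t).
      evar_last.
      + apply (is_derive_plus (K := R_AbsRing) (V := R_NormedModule)
          (fun t => P * E t + D * (t - c) * E t) (fun t => sg * (E t * v t))).
        * apply (is_derive_plus (K := R_AbsRing) (V := R_NormedModule)
            (fun t => P * E t) (fun t => D * (t - c) * E t)).
          -- apply (is_derive_scal E t P); exact HEd.
          -- apply (is_derive_mult (K := R_AbsRing) (fun t => D * (t - c)) E t D); [|exact HEd|apply Rmult_comm].
             auto_derive; [exact I|]; ring.
        * apply (is_derive_scal (fun t => E t * v t)).
          apply (is_derive_mult (K := R_AbsRing) E v t); [exact HEd|exact Hv|apply Rmult_comm].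
      + unfold plus, mult, scal; simpl; unfold mult; simpl. ring.
    - intros t Ht. specialize (Hr t Ht). specialize (HE t).
      apply Rabs_le_between in Hr.
      assert (0 <= D * (t - c) * (k * E t)).
      { repeat apply Rmult_le_pos; lra. }
      assert (- (k * P + D) <= sg * r t) by (destruct Hsg as [-> | ->]; lra).
      assert (E t * - (k * P + D) <= E t * (sg * r t)) by (apply Rmult_le_compat_l; lra).
      lra. }
  assert (E c = 1) as E1 by (unfold E; rewrite Rminus_diag, Rmult_0_r; apply exp_0).
  assert (Ey : exp (- (k * (y - c))) = / E y) by (unfold E; apply exp_Ropp).
  rewrite Ey. pose proof (key 1 (or_introl eq_refl)) as K1.
  pose proof (key (-1) (or_intror eq_refl)) as K2. rewrite E1 in *.
  specialize (HE y).
  apply Rabs_le_between; split; apply (Rmult_le_reg_l (E y)); auto;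
    rewrite Rmult_minus_distr_l; replace (E y * (/ E y * v c)) with (v c) by (field; lra);
    lra.
Qed.

(* [v_- = w - k u] and [v_+ = w + k u] diagonalise the system; [v_-] is damped forwards
   and [v_+] backwards.  The two boundary conditions reflect one into the other, with a
   product of reflection coefficients that is never positive, which keeps the bound
   uniform as [k -> 0]. *)
Lemma bvp_bound (u w E g : R -> R) c b k tau P1 P2 D : 0 <= k -> 0 <= tau <= k -> c <= b ->
  0 <= P1 -> 0 <= P2 -> 0 <= D ->
  (forall t, c <= t <= b -> is_derive u t (w t + E t)) ->
  (forall t, c <= t <= b -> is_derive w t (k ^ 2 * u t + g t)) ->
  (forall t, c <= t <= b -> Rabs (E t) <= P1) ->
  (forall t, c <= t <= b -> Rabs (g t) <= k * P2 + D) ->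
  let M := 4 * (k * Rabs (u b)) + 2 * Rabs (w c - tau * u c)
           + 4 * (P1 + P2 + (b - c) * D) in
  forall y, c <= y <= b -> k * Rabs (u y) <= M /\ Rabs (w y) <= M.
Proof.
  intros Hk Htau Hcb HP1 HP2 HD Hu Hw HE Hg M.
  set (S := P1 + P2 + (b - c) * D).
  assert (HS : 0 <= S) by (unfold S; assert (0 <= (b - c) * D) by (apply Rmult_le_pos; lra); lra).
  assert (Hminus : forall y, c <= y <= b ->
    Rabs ((w y - k * u y) - exp (- (k * (y - c))) * (w c - k * u c)) <= S).
  { intros y Hy.
    eapply Rle_trans; [apply (damped_ode_bound (fun t => w t - k * u t) (fun t => g t - k * E t) c y k (P1 + P2) D); try lra|].
    - intros t Ht. evar_last.
      + apply (is_derive_minus (K := R_AbsRing) (V := R_NormedModule) w (fun t => k * u t)).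
        * apply Hw; lra.
        * apply (is_derive_scal u); apply Hu; lra.
      + unfold minus, plus, opp, scal; simpl; unfold mult; simpl; ring.
    - intros t Ht. specialize (HE t ltac:(lra)); specialize (Hg t ltac:(lra)).
      unfold Rminus; eapply Rle_trans; [apply Rabs_triang|].
      rewrite Rabs_Ropp, Rabs_mult, (Rabs_pos_eq k) by lra.
      assert (k * Rabs (E t) <= k * P1) by (apply Rmult_le_compat_l; lra). lra.
    - unfold S. assert ((y - c) * D <= (b - c) * D) by (apply Rmult_le_compat_r; lra). lra. }
  (* The reflection [t -> - t] turns the backward damping of [w + k u] into the forward damping
     already treated. *)
  assert (Hplus : forall y, c <= y <= b ->
    Rabs ((w y + k * u y) - exp (- (k * (b - y))) * (w b + k * u b)) <= S).
  { intros y Hy.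
    pose proof (damped_ode_bound (fun t => w (- t) + k * u (- t)) (fun t => - g (- t) - k * E (- t))
      (- b) (- y) k (P1 + P2) D) as H. simpl in H.
    rewrite !Ropp_involutive in H.
    replace (- y - - b) with (b - y) in H by ring.
    eapply Rle_trans; [apply H; try lra|].
    - intros t Ht. evar_last.
      + apply (is_derive_plus (K := R_AbsRing) (V := R_NormedModule) (fun t => w (- t)) (fun t => k * u (- t))).
        * apply (is_derive_comp w Ropp).
          -- apply Hw; lra.
          -- apply (is_derive_opp (K := R_AbsRing) (V := R_NormedModule) (fun x => x) t); apply is_derive_id.
        * apply (is_derive_scal (fun t => u (- t))).
          apply (is_derive_comp u Ropp).
          -- apply Hu; lra.
          -- apply (is_derive_opp (K := R_AbsRing) (V := R_NormedModule) (fun x => x) t); apply is_derive_id.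
      + unfold plus, opp, scal, one; simpl; unfold mult; simpl; ring.
    - intros t Ht. specialize (HE (- t) ltac:(lra)); specialize (Hg (- t) ltac:(lra)).
      unfold Rminus; eapply Rle_trans; [apply Rabs_triang|].
      rewrite !Rabs_Ropp, Rabs_mult, (Rabs_pos_eq k) by lra.
      assert (k * Rabs (E (- t)) <= k * P1) by (apply Rmult_le_compat_l; lra). lra.
    - unfold S. assert ((b - y) * D <= (b - c) * D) by (apply Rmult_le_compat_r; lra). lra. }
  assert (Hexp : forall t, 0 <= t -> 0 < exp (- (k * t)) <= 1).
  { intros t Ht; split; [apply exp_pos|]. rewrite <- exp_0.
    assert (0 <= k * t) by now apply Rmult_le_pos.
    destruct (Req_dec (k * t) 0) as [->|]; [rewrite Ropp_0; lra|].
    left; apply exp_increasing; lra. }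
  set (J := w c - tau * u c) in *.
  pose proof (Hminus b ltac:(lra)) as HM. pose proof (Hplus c ltac:(lra)) as HPl.
  pose proof (Hexp (b - c) ltac:(lra)) as He.
  set (e := exp (- (k * (b - c)))) in *.
  set (Im := (w b - k * u b) - e * (w c - k * u c)) in *.
  set (Ip := (w c + k * u c) - e * (w b + k * u b)) in *.
  (* Elimination of [w b] and [w c] from the two damping relations and the Robin datum. The
     coefficient of [u c] is at least [k] because [tau >= 0], so [k |u c|] is bounded without any
     division by [k]. *)
  assert (Eq : u c * (tau * (1 - e ^ 2) + k * (1 + e ^ 2))
               = 2 * (k * u b) * e + (e ^ 2 - 1) * J + e * Im + Ip).
  { unfold Ip, Im, J; ring. }
  assert (He2 : 0 <= e ^ 2 <= 1) by nra.
  assert (HU : k * Rabs (u c) <= 2 * (k * Rabs (u b)) + Rabs J + 2 * S).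
  { assert (H1 : k * Rabs (u c) <= Rabs (u c * (tau * (1 - e ^ 2) + k * (1 + e ^ 2)))).
    { rewrite Rabs_mult, Rmult_comm. apply Rmult_le_compat_l; [apply Rabs_pos|].
      rewrite Rabs_pos_eq; nra. }
    rewrite Eq in H1. eapply Rle_trans; [exact H1|].
    assert (Rabs (2 * (k * u b) * e) <= 2 * (k * Rabs (u b))).
    { rewrite !Rabs_mult, (Rabs_pos_eq 2), (Rabs_pos_eq k), (Rabs_pos_eq e) by lra.
      rewrite <- (Rmult_1_r (2 * (k * Rabs (u b)))) at 2.
      apply Rmult_le_compat_l; [|lra].
      pose proof (Rabs_pos (u b)); assert (0 <= k * Rabs (u b)) by now apply Rmult_le_pos. lra. }
    assert (Rabs ((e ^ 2 - 1) * J) <= Rabs J).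
    { rewrite Rabs_mult, Rabs_left1 by lra. pose proof (Rabs_pos J); nra. }
    assert (Rabs (e * Im) <= S).
    { rewrite Rabs_mult, (Rabs_pos_eq e) by lra. pose proof (Rabs_pos Im); nra. }
    eapply Rle_trans; [apply Rabs_triang|].
    eapply Rle_trans; [apply Rplus_le_compat_r, Rabs_triang|].
    eapply Rle_trans; [apply Rplus_le_compat_r, Rplus_le_compat_r, Rabs_triang|]. lra. }
  set (Q := 2 * (k * Rabs (u b)) + Rabs J + 2 * S) in *.
  (* Reflection at the lower end; [|tau - k| <= k] keeps the coefficient of [u c] below [k]. *)
  assert (Hvc : Rabs (w c - k * u c) <= Q + Rabs J).
  { replace (w c - k * u c) with ((tau - k) * u c + J) by (unfold J; ring).
    eapply Rle_trans; [apply Rabs_triang|].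
    apply Rplus_le_compat_r. eapply Rle_trans; [|exact HU].
    rewrite Rabs_mult. apply Rmult_le_compat_r; [apply Rabs_pos|].
    rewrite Rabs_left1; lra. }
  assert (Hvm : forall y, c <= y <= b -> Rabs (w y - k * u y) <= Q + Rabs J + S).
  { intros y Hy. specialize (Hminus y Hy). specialize (Hexp (y - c) ltac:(lra)).
    set (e' := exp (- (k * (y - c)))) in *.
    replace (w y - k * u y) with (e' * (w c - k * u c) + (w y - k * u y - e' * (w c - k * u c))) by ring.
    eapply Rle_trans; [apply Rabs_triang|]. apply Rplus_le_compat; auto.
    rewrite Rabs_mult, (Rabs_pos_eq e') by lra.
    pose proof (Rabs_pos (w c - k * u c)); nra. }
  assert (Hvb : Rabs (w b + k * u b) <= Q + Rabs J + S + 2 * (k * Rabs (u b))).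
  { replace (w b + k * u b) with ((w b - k * u b) + 2 * (k * u b)) by ring.
    eapply Rle_trans; [apply Rabs_triang|]. apply Rplus_le_compat; [apply Hvm; lra|].
    rewrite !Rabs_mult, (Rabs_pos_eq 2), (Rabs_pos_eq k) by lra. lra. }
  (* The largest of the bounds, since it has been reflected at both ends; it is the one that fixes
     the constants in [M]. *)
  assert (Hvp : forall y, c <= y <= b -> Rabs (w y + k * u y) <= M).
  { intros y Hy. specialize (Hplus y Hy). specialize (Hexp (b - y) ltac:(lra)).
    set (e' := exp (- (k * (b - y)))) in *.
    replace (w y + k * u y) with (e' * (w b + k * u b) + (w y + k * u y - e' * (w b + k * u b))) by ring.
    eapply Rle_trans; [apply Rabs_triang|].
    assert (Rabs (e' * (w b + k * u b)) <= Rabs (w b + k * u b)).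
    { rewrite Rabs_mult, (Rabs_pos_eq e') by lra.
      pose proof (Rabs_pos (w b + k * u b)); nra. }
    unfold M, Q in *; fold S; lra. }
  assert (HQM : Q + Rabs J + S <= M).
  { unfold M, Q; fold S. pose proof (Rabs_pos (u b)).
    assert (0 <= k * Rabs (u b)) by now apply Rmult_le_pos. lra. }
  intros y Hy. specialize (Hvp y Hy); specialize (Hvm y Hy).
  assert (Rabs (w y - k * u y) <= M) by lra.
  apply Rabs_le_between in Hvp. apply Rabs_le_between in H.
  split.
  - rewrite <- (Rabs_pos_eq k) at 1 by lra. rewrite <- Rabs_mult. apply Rabs_le_between; lra.
  - apply Rabs_le_between; lra.
Qed.

(** * Derivatives relative to a closed interval, and the boundary value problem up to the end
    points *)

Definition deriv_in (lo hi : R) (f : R -> R) (y l : R) : Prop :=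
  forall eps, 0 < eps -> exists delta, 0 < delta /\
    forall t, lo <= t <= hi -> Rabs (t - y) < delta ->
      Rabs (f t - f y - (t - y) * l) <= eps * Rabs (t - y).

Lemma Rabs_fst_le (z : C) : Rabs (fst z) <= Cmod z.
Proof. eapply Rle_trans; [apply Rmax_l|apply Rmax_Cmod]. Qed.

Lemma Rabs_snd_le (z : C) : Rabs (snd z) <= Cmod z.
Proof. eapply Rle_trans; [apply Rmax_r|apply Rmax_Cmod]. Qed.

Lemma Cmod_le_abs (z : C) : Cmod z <= Rabs (fst z) + Rabs (snd z).
Proof.
  unfold Cmod. rewrite <- (sqrt_pow2 (Rabs (fst z) + Rabs (snd z))).
  - apply sqrt_le_1_alt. rewrite <- (pow2_abs (fst z)), <- (pow2_abs (snd z)).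
    pose proof (Rabs_pos (fst z)); pose proof (Rabs_pos (snd z)); nra.
  - pose proof (Rabs_pos (fst z)); pose proof (Rabs_pos (snd z)); lra.
Qed.

Lemma deriv_in_fst lo hi g y l :
  has_deriv_in lo hi g y l -> deriv_in lo hi (fun t => fst (g t)) y (fst l).
Proof.
  intros H eps He; destruct (H eps He) as [delta [Hd Hb]]; exists delta; split; auto.
  intros t Ht Hty; eapply Rle_trans; [|apply (Hb t Ht Hty)].
  eapply Rle_trans; [|apply Rabs_fst_le]. right; f_equal; simpl; ring.
Qed.

Lemma deriv_in_snd lo hi g y l :
  has_deriv_in lo hi g y l -> deriv_in lo hi (fun t => snd (g t)) y (snd l).
Proof.
  intros H eps He; destruct (H eps He) as [delta [Hd Hb]]; exists delta; split; auto.
  intros t Ht Hty; eapply Rle_trans; [|apply (Hb t Ht Hty)].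
  eapply Rle_trans; [|apply Rabs_snd_le]. right; f_equal; simpl; ring.
Qed.

Lemma deriv_in_is_derive lo hi f y l : lo < y < hi -> deriv_in lo hi f y l -> is_derive f y l.
Proof.
  intros Hy H. apply is_derive_Reals. intros eps He.
  destruct (H (eps / 2) ltac:(lra)) as [delta [Hd Hb]].
  assert (Hm : 0 < Rmin delta (Rmin (y - lo) (hi - y))).
  { repeat apply Rmin_pos; lra. }
  exists (mkposreal _ Hm); intros t Ht Hlt; simpl in Hlt.
  pose proof (Rmin_l delta (Rmin (y - lo) (hi - y))).
  pose proof (Rmin_r delta (Rmin (y - lo) (hi - y))).
  pose proof (Rmin_l (y - lo) (hi - y)). pose proof (Rmin_r (y - lo) (hi - y)).
  assert (Habs : Rabs t < delta) by lra.
  assert (Hr : - (Rmin (y - lo) (hi - y)) < t < Rmin (y - lo) (hi - y)).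
  { apply Rabs_def2 in Hlt; lra. }
  specialize (Hb (y + t) ltac:(lra)). replace (y + t - y) with t in Hb by ring.
  specialize (Hb Habs).
  replace ((f (y + t) - f y) / t - l) with ((f (y + t) - f y - t * l) / t) by (field; auto).
  unfold Rdiv at 1; rewrite Rabs_mult, Rabs_inv.
  assert (0 < Rabs t) by now apply Rabs_pos_lt.
  apply (Rmult_lt_reg_r (Rabs t)); auto. rewrite Rmult_assoc, Rinv_l by lra. nra.
Qed.

Lemma deriv_in_cont lo hi f y l : deriv_in lo hi f y l ->
  forall eps, 0 < eps -> exists delta, 0 < delta /\
    forall t, lo <= t <= hi -> Rabs (t - y) < delta -> Rabs (f t - f y) <= eps.
Proof.
  intros H eps He. destruct (H 1 Rlt_0_1) as [delta [Hd Hb]].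
  assert (0 < eps / (1 + Rabs l)) by (apply Rdiv_lt_0_compat; pose proof (Rabs_pos l); lra).
  exists (Rmin delta (eps / (1 + Rabs l))); split; [now apply Rmin_pos|].
  intros t Ht Hty.
  pose proof (Rmin_l delta (eps / (1 + Rabs l))); pose proof (Rmin_r delta (eps / (1 + Rabs l))).
  specialize (Hb t Ht ltac:(lra)).
  replace (f t - f y) with ((f t - f y - (t - y) * l) + (t - y) * l) by ring.
  eapply Rle_trans; [apply Rabs_triang|]. rewrite Rabs_mult.
  pose proof (Rabs_pos l); pose proof (Rabs_pos (t - y)).
  assert (Rabs (t - y) * (1 + Rabs l) <= eps / (1 + Rabs l) * (1 + Rabs l)).
  { apply Rmult_le_compat_r; lra. }
  replace (eps / (1 + Rabs l) * (1 + Rabs l)) with eps in * by (field; lra). lra.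
Qed.

(* A derivative on a closed interval need not be continuous, but its value at any point,
   endpoints included, is a limit of values at interior points. *)
Lemma deriv_in_near lo hi f df : lo < hi ->
  (forall y, lo <= y <= hi -> deriv_in lo hi f y (df y)) ->
  forall y, lo <= y <= hi -> forall eps, 0 < eps ->
  exists c, lo < c < hi /\ Rabs (c - y) < eps /\ Rabs (df c - df y) <= eps.
Proof.
  intros Hlh Hd y Hy eps He.
  destruct (Hd y Hy (eps / 3) ltac:(lra)) as [delta [Hdel Hb]].
  (* [sg] points from [y] towards the farther end of the interval, so that there is room of at least
     half its length. *)
  assert (Hs : exists sg, (sg = 1 /\ y <= (lo + hi) / 2) \/ (sg = -1 /\ (lo + hi) / 2 <= y)).
  { destruct (Rle_dec y ((lo + hi) / 2)); [exists 1; auto|exists (-1); right; split; auto; lra]. }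
  destruct Hs as [sg Hs].
  (* The mean value theorem will be used between distances [eta] and [2 eta] from [y]. The two
     first-order errors there are [eps / 3 * eta] and [eps / 3 * (2 * eta)], which add up to
     [eps * eta]; the bound [(hi - lo) / 5] keeps [2 eta] below half the length. *)
  set (eta := Rmin (delta / 3) (Rmin (eps / 3) ((hi - lo) / 5))).
  assert (Heta : 0 < eta) by (unfold eta; repeat apply Rmin_pos; lra).
  assert (eta <= delta / 3) by apply Rmin_l.
  assert (eta <= eps / 3) by (eapply Rle_trans; [apply Rmin_r|apply Rmin_l]).
  assert (eta <= (hi - lo) / 5) by (eapply Rle_trans; [apply Rmin_r|apply Rmin_r]).
  assert (Hin : forall t, Rmin (y + sg * eta) (y + sg * (2 * eta)) <= t
                          <= Rmax (y + sg * eta) (y + sg * (2 * eta)) ->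
                lo < t < hi /\ Rabs (t - y) <= 2 * eta).
  { intros t. destruct Hs as [[-> Hs]|[-> Hs]].
    - rewrite Rmin_left, Rmax_right by lra; intros Ht; split; [lra|apply Rabs_le_between; lra].
    - rewrite Rmin_right, Rmax_left by lra; intros Ht; split; [lra|apply Rabs_le_between; lra]. }
  assert (Hsg : Rabs sg = 1).
  { destruct Hs as [[-> _]|[-> _]]; [apply Rabs_R1|rewrite Rabs_left; lra]. }
  destruct (MVT_gen f (y + sg * eta) (y + sg * (2 * eta)) df) as [c [Hc E]].
  - intros x Hx. destruct (Hin x ltac:(lra)) as [Hx' _].
    apply deriv_in_is_derive with lo hi; auto; apply Hd; lra.
  - intros x Hx. destruct (Hin x Hx) as [Hx' _].
    apply continuity_pt_filterlim. apply (ex_derive_continuous f x); exists (df x).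
    apply deriv_in_is_derive with lo hi; auto; apply Hd; lra.
  - exists c. destruct (Hin c Hc) as [Hc1 Hc2]. split; [auto|split; [lra|]].
    assert (Hf1 : Rabs (f (y + sg * eta) - f y - sg * eta * df y) <= eps / 3 * eta).
    { assert (Rabs (y + sg * eta - y) = eta) as Ea.
      { replace (y + sg * eta - y) with (sg * eta) by ring.
        rewrite Rabs_mult, Hsg, Rabs_pos_eq; lra. }
      destruct (Hin (y + sg * eta)) as [Hx _]; [split; [apply Rmin_l|apply Rmax_l]|].
      specialize (Hb (y + sg * eta) ltac:(lra)). rewrite Ea in Hb.
      replace (y + sg * eta - y) with (sg * eta) in Hb by ring. apply Hb; lra. }
    assert (Hf2 : Rabs (f (y + sg * (2 * eta)) - f y - sg * (2 * eta) * df y) <= eps / 3 * (2 * eta)).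
    { assert (Rabs (y + sg * (2 * eta) - y) = 2 * eta) as Ea.
      { replace (y + sg * (2 * eta) - y) with (sg * (2 * eta)) by ring.
        rewrite Rabs_mult, Hsg, Rabs_pos_eq; lra. }
      destruct (Hin (y + sg * (2 * eta))) as [Hx _]; [split; [apply Rmin_r|apply Rmax_r]|].
      specialize (Hb (y + sg * (2 * eta)) ltac:(lra)). rewrite Ea in Hb.
      replace (y + sg * (2 * eta) - y) with (sg * (2 * eta)) in Hb by ring. apply Hb; lra. }
    apply (Rmult_le_reg_r eta); auto.
    replace (Rabs (df c - df y) * eta) with (Rabs (sg * eta * (df c - df y))).
    2: { rewrite !Rabs_mult, Hsg, (Rabs_pos_eq eta); lra. }
    replace (sg * eta * (df c - df y)) with
      ((f (y + sg * (2 * eta)) - f y - sg * (2 * eta) * df y)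
       - (f (y + sg * eta) - f y - sg * eta * df y)).
    2: { replace (y + sg * (2 * eta) - (y + sg * eta)) with (sg * eta) in E by ring.
         transitivity (f (y + sg * (2 * eta)) - f (y + sg * eta) - sg * eta * df y); [ring|].
         rewrite E; ring. }
    unfold Rminus at 1; eapply Rle_trans; [apply Rabs_triang|]. rewrite Rabs_Ropp. lra.
Qed.

Lemma le_of_le_add_eps x M C : 0 <= C -> (forall eps, 0 < eps -> x <= M + C * eps) -> x <= M.
Proof.
  intros HC H. apply Rnot_lt_le; intro Hlt.
  assert (0 < (x - M) / (2 * (C + 1))) by (apply Rdiv_lt_0_compat; lra).
  specialize (H _ H0).
  assert (C * ((x - M) / (2 * (C + 1))) <= (x - M) / 2).
  { replace ((x - M) / 2) with ((C + 1) * ((x - M) / (2 * (C + 1)))) by (field; lra).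
    apply Rmult_le_compat_r; lra. }
  lra.
Qed.

(** The equation is assumed only at interior points, so [bvp_bound] is applied on [[c, b]] inside
    [(-a, 0)] and both ends are pushed to the boundary. At the lower end [du] need not be
    continuous: [c] is chosen by [deriv_in_near], and the factor [a + y] in the bound on [Fy] makes
    the Robin datum of [du - Fy] at [c] approach that of [du] at [-a]. The estimate then passes to
    [y = -a] and [y = 0] in the same manner. *)
Lemma bvp_bound_closed (u du Fy g : R -> R) a k tau P1 P2 D :
  0 < a -> 0 <= k -> 0 <= tau <= k -> 0 <= P1 -> 0 <= P2 -> 0 <= D ->
  (forall y, - a <= y <= 0 -> deriv_in (- a) 0 u y (du y)) ->
  (forall y, - a < y < 0 -> exists u2 l, deriv_in (- a) 0 du y u2 /\
     deriv_in (- a) 0 Fy y l /\ u2 - k ^ 2 * u y = g y + l) ->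
  (forall y, - a < y < 0 -> Rabs (Fy y) <= (a + y) * P1) ->
  (forall y, - a < y < 0 -> Rabs (g y) <= k * P2 + D) ->
  let M := 4 * (k * Rabs (u 0)) + 2 * Rabs (du (- a) - tau * u (- a))
           + 4 * (a * P1 + P2 + a * D) + a * P1 in
  forall y, - a <= y <= 0 -> k * Rabs (u y) <= M /\ Rabs (du y) <= M.
Proof.
  intros Ha Hk Htau HP1 HP2 HD Hu Heq HF Hg M.
  assert (interior : forall y, - a < y < 0 -> k * Rabs (u y) <= M /\ Rabs (du y) <= M).
  { intros y Hy.
    (* [M - a * P1] is the bound for [w = du - Fy]; the reserved [a * P1] pays for adding [Fy]
       back. *)
    assert (appr : forall eps, 0 < eps ->
       k * Rabs (u y) <= M - a * P1 + (4 * k + 2 * (2 + tau)) * eps /\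
       Rabs (du y - Fy y) <= M - a * P1 + (4 * k + 2 * (2 + tau)) * eps).
    { intros eps He.
      destruct (deriv_in_cont _ _ _ _ _ (Hu 0 ltac:(lra)) eps He) as [d1 [Hd1 Hb1]].
      destruct (deriv_in_cont _ _ _ _ _ (Hu (- a) ltac:(lra)) eps He) as [d2 [Hd2 Hb2]].
      (* The four entries ensure, in this order, that [u c] is close to [u (- a)], that [Fy c] is at
         most [eps], that [du c] is close to [du (- a)], and that [c] lies to the left of [y]. *)
      assert (Hmin : 0 < Rmin (Rmin d2 (eps / (P1 + 1))) (Rmin eps (y + a))).
      { repeat apply Rmin_pos; try lra. apply Rdiv_lt_0_compat; lra. }
      destruct (deriv_in_near (- a) 0 u du ltac:(lra) Hu (- a) ltac:(lra) _ Hmin)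
        as [c [Hc [Hca Hdc]]].
      set (mu := Rmin (Rmin d2 (eps / (P1 + 1))) (Rmin eps (y + a))) in *.
      assert (mu <= d2) by (eapply Rle_trans; [apply Rmin_l|apply Rmin_l]).
      assert (mu <= eps / (P1 + 1)) by (eapply Rle_trans; [apply Rmin_l|apply Rmin_r]).
      assert (mu <= eps) by (eapply Rle_trans; [apply Rmin_r|apply Rmin_l]).
      assert (mu <= y + a) by (eapply Rle_trans; [apply Rmin_r|apply Rmin_r]).
      specialize (Hb2 c ltac:(lra) ltac:(lra)).
      rewrite Rabs_pos_eq in Hca by lra.
      set (b := - (Rmin (d1 / 2) (- y / 2))).
      pose proof (Rmin_l (d1 / 2) (- y / 2)); pose proof (Rmin_r (d1 / 2) (- y / 2)).
      assert (0 < Rmin (d1 / 2) (- y / 2)) by (apply Rmin_pos; lra).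
      assert (Hb : y < b < 0) by (unfold b; lra).
      assert (Hbd : Rabs (b - 0) < d1) by (unfold b; rewrite Rminus_0_r, Rabs_Ropp, Rabs_pos_eq; lra).
      specialize (Hb1 b ltac:(lra) Hbd).
      pose proof (bvp_bound u (fun t => du t - Fy t) Fy g c b k tau (a * P1) P2 D) as HB.
      assert (HaP : 0 <= a * P1) by (apply Rmult_le_pos; lra).
      specialize (HB Hk Htau ltac:(lra) HaP HP2 HD).
      assert (D1 : forall t, c <= t <= b -> is_derive u t (du t - Fy t + Fy t)).
      { intros t Ht. replace (du t - Fy t + Fy t) with (du t) by ring.
        apply deriv_in_is_derive with (- a) 0; [lra|apply Hu; lra]. }
      assert (D2 : forall t, c <= t <= b -> is_derive (fun t => du t - Fy t) t (k ^ 2 * u t + g t)).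
      { intros t Ht. destruct (Heq t ltac:(lra)) as [u2 [l [E1 [E2 E3]]]].
        replace (k ^ 2 * u t + g t) with (u2 - l) by lra.
        apply (is_derive_minus (K := R_AbsRing) (V := R_NormedModule) du Fy);
          apply deriv_in_is_derive with (- a) 0; auto; lra. }
      assert (D3 : forall t, c <= t <= b -> Rabs (Fy t) <= a * P1).
      { intros t Ht; eapply Rle_trans; [apply HF; lra|]. apply Rmult_le_compat_r; lra. }
      assert (D4 : forall t, c <= t <= b -> Rabs (g t) <= k * P2 + D).
      { intros t Ht; apply Hg; lra. }
      specialize (HB D1 D2 D3 D4 y ltac:(lra)). simpl in HB.
      assert (B1 : k * Rabs (u b) <= k * Rabs (u 0) + k * eps).
      { rewrite <- Rmult_plus_distr_l. apply Rmult_le_compat_l; auto.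
        replace (u b) with (u 0 + (u b - u 0)) by ring.
        eapply Rle_trans; [apply Rabs_triang|]. lra. }
      assert (B2 : Rabs (du c - Fy c - tau * u c)
                   <= Rabs (du (- a) - tau * u (- a)) + (2 + tau) * eps).
      { replace (du c - Fy c - tau * u c) with
          ((du (- a) - tau * u (- a)) + ((du c - du (- a)) + (- Fy c + - (tau * (u c - u (- a)))))) by ring.
        eapply Rle_trans; [apply Rabs_triang|]. apply Rplus_le_compat_l.
        eapply Rle_trans; [apply Rabs_triang|].
        assert (Rabs (- Fy c + - (tau * (u c - u (- a)))) <= eps + tau * eps).
        { eapply Rle_trans; [apply Rabs_triang|]. rewrite !Rabs_Ropp, Rabs_mult, (Rabs_pos_eq tau) by lra.
          apply Rplus_le_compat; [|apply Rmult_le_compat_l; lra].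
          eapply Rle_trans; [apply HF; lra|].
          apply Rle_trans with (eps / (P1 + 1) * P1).
          - apply Rmult_le_compat_r; lra.
          - apply (Rmult_le_reg_r (P1 + 1)); [lra|].
            replace (eps / (P1 + 1) * P1 * (P1 + 1)) with (eps * P1) by (field; lra). nra. }
        lra. }
      assert (B3 : (b - c) * D <= a * D) by (apply Rmult_le_compat_r; lra).
      unfold M; split; eapply Rle_trans; try apply HB; lra. }
    assert (HC : 0 <= 4 * k + 2 * (2 + tau)) by lra.
    assert (HaP : 0 <= a * P1) by (apply Rmult_le_pos; lra).
    split.
    - apply Rle_trans with (M - a * P1); [|lra]. apply le_of_le_add_eps with (1 := HC); intros; now apply appr.
    - assert (Rabs (du y - Fy y) <= M - a * P1).
      { apply le_of_le_add_eps with (1 := HC); intros; now apply appr. }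
      replace (du y) with ((du y - Fy y) + Fy y) by ring.
      eapply Rle_trans; [apply Rabs_triang|]. specialize (HF y Hy).
      assert ((a + y) * P1 <= a * P1) by (apply Rmult_le_compat_r; lra). lra. }
  intros y Hy. split.
  - apply le_of_le_add_eps with (C := k); auto. intros eps He.
    destruct (deriv_in_cont _ _ _ _ _ (Hu y Hy) eps He) as [d1 [Hd1 Hb1]].
    destruct (deriv_in_near (- a) 0 u du ltac:(lra) Hu y Hy d1 Hd1) as [c [Hc [Hcy _]]].
    specialize (Hb1 c ltac:(lra) Hcy). rewrite Rabs_minus_sym in Hb1.
    destruct (interior c Hc) as [Hi _].
    replace (u y) with (u c + (u y - u c)) by ring.
    pose proof (Rabs_triang (u c) (u y - u c)).
    assert (k * Rabs (u c + (u y - u c)) <= k * (Rabs (u c) + eps)) by (apply Rmult_le_compat_l; lra).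
    lra.
  - apply le_of_le_add_eps with (C := 1); [lra|]. intros eps He.
    destruct (deriv_in_near (- a) 0 u du ltac:(lra) Hu y Hy eps He) as [c [Hc [_ Hcy]]].
    destruct (interior c Hc) as [_ Hi]. rewrite Rabs_minus_sym in Hcy.
    replace (du y) with (du c + (du y - du c)) by ring.
    pose proof (Rabs_triang (du c) (du y - du c)). lra.
Qed.

(** As [k] and [tau] are real, real and imaginary parts decouple. Adding the two real bounds doubles
    the constants; the largest one, [10 = 2 (4 + 1)], occurs at [a * P1] and is used throughout. *)
Lemma bvp_bound_complex (u du Fy g : R -> C) a k tau P1 P2 D :
  0 < a -> 0 <= k -> 0 <= tau <= k -> 0 <= P1 -> 0 <= P2 -> 0 <= D ->
  (forall y, - a <= y <= 0 -> has_deriv_in (- a) 0 u y (du y)) ->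
  (forall y, - a < y < 0 -> exists u2 l, has_deriv_in (- a) 0 du y u2 /\
     has_deriv_in (- a) 0 Fy y l /\ (u2 - RtoC (k ^ 2) * u y = g y + l)%C) ->
  (forall y, - a < y < 0 -> Cmod (Fy y) <= (a + y) * P1) ->
  (forall y, - a < y < 0 -> Cmod (g y) <= k * P2 + D) ->
  let M := 10 * (k * Cmod (u 0) + Cmod (du (- a)%R - RtoC tau * u (- a)%R)%C
                 + (a * P1 + P2 + a * D)) in
  forall y, - a <= y <= 0 -> k * Cmod (u y) <= M /\ Cmod (du y) <= M.
Proof.
  intros Ha Hk Htau HP1 HP2 HD Hu Heq HF Hg M y Hy.
  pose proof (bvp_bound_closed (fun t => fst (u t)) (fun t => fst (du t)) (fun t => fst (Fy t))
    (fun t => fst (g t)) a k tau P1 P2 D Ha Hk Htau HP1 HP2 HD) as H1.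
  pose proof (bvp_bound_closed (fun t => snd (u t)) (fun t => snd (du t)) (fun t => snd (Fy t))
    (fun t => snd (g t)) a k tau P1 P2 D Ha Hk Htau HP1 HP2 HD) as H2.
  simpl in H1, H2.
  lapply H1; [clear H1; intros H1|intros; now apply deriv_in_fst, Hu].
  lapply H2; [clear H2; intros H2|intros; now apply deriv_in_snd, Hu].
  lapply H1; [clear H1; intros H1|].
  2: { intros t Ht; destruct (Heq t Ht) as [u2 [l [E1 [E2 E3]]]]; exists (fst u2), (fst l).
       split; [now apply deriv_in_fst|split; [now apply deriv_in_fst|]].
       apply (f_equal fst) in E3; simpl in E3. lra. }
  lapply H2; [clear H2; intros H2|].
  2: { intros t Ht; destruct (Heq t Ht) as [u2 [l [E1 [E2 E3]]]]; exists (snd u2), (snd l).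
       split; [now apply deriv_in_snd|split; [now apply deriv_in_snd|]].
       apply (f_equal snd) in E3; simpl in E3. lra. }
  lapply H1; [clear H1; intros H1|intros t Ht; eapply Rle_trans; [apply Rabs_fst_le|now apply HF]].
  lapply H2; [clear H2; intros H2|intros t Ht; eapply Rle_trans; [apply Rabs_snd_le|now apply HF]].
  lapply H1; [clear H1; intros H1|intros t Ht; eapply Rle_trans; [apply Rabs_fst_le|now apply Hg]].
  lapply H2; [clear H2; intros H2|intros t Ht; eapply Rle_trans; [apply Rabs_snd_le|now apply Hg]].
  specialize (H1 y Hy); specialize (H2 y Hy).
  set (J := (du (- a)%R - RtoC tau * u (- a)%R)%C) in *.
  assert (E1 : fst (du (- a)) - tau * fst (u (- a)) = fst J) by (unfold J; simpl; ring).
  assert (E2 : snd (du (- a)) - tau * snd (u (- a)) = snd J) by (unfold J; simpl; ring).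
  rewrite E1 in H1; rewrite E2 in H2.
  pose proof (Rabs_fst_le J); pose proof (Rabs_snd_le J).
  assert (k * Rabs (fst (u 0)) <= k * Cmod (u 0)) by (apply Rmult_le_compat_l; [auto|apply Rabs_fst_le]).
  assert (k * Rabs (snd (u 0)) <= k * Cmod (u 0)) by (apply Rmult_le_compat_l; [auto|apply Rabs_snd_le]).
  assert (0 <= k * Cmod (u 0)) by (apply Rmult_le_pos; [auto|apply Cmod_ge_0]).
  pose proof (Cmod_ge_0 J).
  assert (0 <= a * P1) by (apply Rmult_le_pos; lra).
  assert (0 <= a * D) by (apply Rmult_le_pos; lra).
  unfold M; split.
  - apply Rle_trans with (k * (Rabs (fst (u y)) + Rabs (snd (u y)))).
    + apply Rmult_le_compat_l; [auto|apply Cmod_le_abs].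
    + lra.
  - eapply Rle_trans; [apply Cmod_le_abs|]. lra.
Qed.

(** * Weighted square-summable majorants *)

(** States that a nonnegative sequence has [H^s] norm at most [m]. As a predicate about all finite
    boxes it carries no convergence claim, and upper bounds can be added and multiplied without ever
    computing a norm. *)
Definition l2w (d s : nat) (g : list Z -> R) (m : R) : Prop :=
  0 <= m /\ (forall p, length p = d -> 0 <= g p) /\
  forall N, lsum (box d N) (fun p => (1 + zsq p) ^ s * g p ^ 2) <= m ^ 2.

Lemma l2w_le d s f g m m' : l2w d s g m -> m <= m' ->
  (forall p, length p = d -> 0 <= f p <= g p) -> l2w d s f m'.
Proof.
  intros [Hm [Hg H]] Hmm Hf; split; [lra|split; [intros; now apply Hf|]].
  intros N; apply Rle_trans with (m ^ 2); [|apply pow_incr; lra].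
  eapply Rle_trans; [|apply (H N)].
  apply lsum_le; intros p Hp; apply box_length in Hp.
  apply Rmult_le_compat_l; [left; apply weight_pos|]. apply pow_incr; auto.
Qed.

Lemma l2w_zero d s : l2w d s (fun _ => 0) 0.
Proof.
  split; [lra|split; [intros; lra|]]. intros N; right.
  rewrite (lsum_ext _ _ (fun _ => 0)) by (intros; ring). rewrite lsum_zero; ring.
Qed.

Lemma l2w_scal d s c g m : 0 <= c -> l2w d s g m -> l2w d s (fun p => c * g p) (c * m).
Proof.
  intros Hc [Hm [Hg H]]; split; [now apply Rmult_le_pos|split].
  - intros; apply Rmult_le_pos; auto.
  - intros N. rewrite (lsum_ext _ _ (fun p => c ^ 2 * ((1 + zsq p) ^ s * g p ^ 2)))
      by (intros; ring).
    rewrite lsum_scal. replace ((c * m) ^ 2) with (c ^ 2 * m ^ 2) by ring.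
    apply Rmult_le_compat_l; [apply pow2_ge_0|apply H].
Qed.

Lemma sqrt_weight_sq p s : sqrt ((1 + zsq p) ^ s) ^ 2 = (1 + zsq p) ^ s.
Proof. rewrite pow2_sqrt; auto; left; apply weight_pos. Qed.

Lemma l2w_plus d s f g m m' : l2w d s f m -> l2w d s g m' ->
  l2w d s (fun p => f p + g p) (m + m').
Proof.
  intros [Hm [Hf H]] [Hm' [Hg H']]; split; [lra|split].
  - intros p Hp; specialize (Hf p Hp); specialize (Hg p Hp); lra.
  - intros N.
    assert (E : forall h : list Z -> R, lsum (box d N) (fun p => (1 + zsq p) ^ s * h p ^ 2)
       = lsum (box d N) (fun p => (sqrt ((1 + zsq p) ^ s) * h p) ^ 2)).
    { intros h; apply lsum_ext; intros p _. rewrite Rpow_mult_distr, sqrt_weight_sq; auto. }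
    specialize (H N); specialize (H' N). rewrite E in *.
    rewrite (lsum_ext _ _ (fun p => (sqrt ((1 + zsq p) ^ s) * f p
                                     + sqrt ((1 + zsq p) ^ s) * g p) ^ 2))
      by (intros; ring).
    now apply lsum_minkowski.
Qed.

Lemma l2w_pointwise d s g m p : l2w d s g m -> length p = d -> g p <= m.
Proof.
  intros [Hm [Hg H]] Hp. destruct (exists_box d p Hp) as [N HN].
  assert (g p ^ 2 <= m ^ 2).
  { eapply Rle_trans; [|apply (H N)].
    eapply Rle_trans; [|apply (lsum_in _ _ p)]; auto.
    - assert (1 <= (1 + zsq p) ^ s) by (apply pow_R1_Rle; pose proof (zsq_nonneg p); lra).
      pose proof (pow2_ge_0 (g p)); nra.
    - intros q _; apply Rmult_le_pos; [left; apply weight_pos|apply pow2_ge_0]. }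
  specialize (Hg p Hp); nra.
Qed.

(** * The convolution algebra property of weighted [l^2] *)

Lemma weight_sub_le p q s : length p = length q ->
  (1 + zsq p) ^ s <= 4 ^ s * ((1 + zsq (zsub p q)) ^ s + (1 + zsq q) ^ s).
Proof.
  intros Hl.
  (* From [|p|^2 <= 2 |p - q|^2 + 2 |q|^2]. The larger of the two weights, multiplied by [4], then
     dominates, and its [s]-th power is below the sum of both. *)
  assert (H : 1 + zsq p <= 2 * (1 + zsq (zsub p q)) + 2 * (1 + zsq q)).
  { assert (zsq p <= 2 * zsq (zsub p q) + 2 * zsq q); [|lra].
    revert q Hl; induction p as [|z p IH]; intros [|w q] Hl; try discriminate.
    - unfold zsq; simpl; lra.
    - change (zsq (zsub (z :: p) (w :: q))) with (IZR (z - w) ^ 2 + zsq (zsub p q)).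
      change (zsq (z :: p)) with (IZR z ^ 2 + zsq p).
      change (zsq (w :: q)) with (IZR w ^ 2 + zsq q).
      rewrite minus_IZR. specialize (IH q ltac:(simpl in Hl; lia)).
      pose proof (pow2_ge_0 (IZR z - 2 * IZR w)). nra. }
  pose proof (zsq_nonneg p); pose proof (zsq_nonneg q) as Hq; pose proof (zsq_nonneg (zsub p q)) as Hpq.
  pose proof (weight_pos q s); pose proof (weight_pos (zsub p q) s).
  assert (0 < 4 ^ s) by (apply pow_lt; lra).
  destruct (Rle_dec (zsq (zsub p q)) (zsq q)).
  - apply Rle_trans with ((4 * (1 + zsq q)) ^ s); [apply pow_incr; lra|].
    rewrite Rpow_mult_distr. apply Rmult_le_compat_l; lra.
  - apply Rle_trans with ((4 * (1 + zsq (zsub p q))) ^ s); [apply pow_incr; lra|].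
    rewrite Rpow_mult_distr. apply Rmult_le_compat_l; lra.
Qed.

(** [4^s] comes from [weight_sub_le]; the factor [2] counts the inverse weights at [q] and at
    [p - q], each summing to at most [weight_sum_bound]. *)
Definition conv_sq_const (d s : nat) : R := 2 * 4 ^ s * weight_sum_bound d s.

Lemma conv_sq_const_nonneg d s : 0 <= conv_sq_const d s.
Proof.
  unfold conv_sq_const, weight_sum_bound.
  repeat apply Rmult_le_pos; try apply pow_le; try lra; apply pos_INR.
Qed.

(** A substitute for the square root of [conv_sq_const]: [(1 + x)^2 >= x] for [x >= 0]. *)
Definition conv_const (d s : nat) : R := 1 + conv_sq_const d s.

(* Cauchy-Schwarz against the weights, which are summable because [s > d / 2]. *)
Lemma conv_partial_pointwise d s f g N M p : (d < 2 * s)%nat -> In p (box d N) ->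
  (1 + zsq p) ^ s * lsum (box d M) (fun q => f (zsub p q) * g q) ^ 2
  <= conv_sq_const d s * lsum (box d M) (fun q =>
       ((1 + zsq (zsub p q)) ^ s * f (zsub p q) ^ 2) * ((1 + zsq q) ^ s * g q ^ 2)).
Proof.
  intros Hs Hp.
  set (w := fun q => (1 + zsq q) ^ s).
  assert (Hw : forall q, 0 < w q) by (intros; apply weight_pos).
  (* The product is split as [1 / r] times [r f g], so that Cauchy-Schwarz leaves the weighted
     squares of [f] and [g] in one factor and summable inverse weights in the other. *)
  set (r := fun q => sqrt (w (zsub p q) * w q)).
  assert (Hr : forall q, 0 < r q) by (intros; apply sqrt_lt_R0, Rmult_lt_0_compat; auto).
  assert (Hr2 : forall q, r q ^ 2 = w (zsub p q) * w q).
  { intros; apply pow2_sqrt; left; apply Rmult_lt_0_compat; auto. }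
  rewrite (lsum_ext _ (fun q => f (zsub p q) * g q)
             (fun q => / r q * (r q * (f (zsub p q) * g q)))).
  2: { intros q _; specialize (Hr q); field; lra. }
  apply Rle_trans with (w p * (lsum (box d M) (fun q => (/ r q) ^ 2)
     * lsum (box d M) (fun q => (r q * (f (zsub p q) * g q)) ^ 2))).
  { apply Rmult_le_compat_l; [left; apply Hw|apply lsum_cauchy_schwarz]. }
  rewrite <- Rmult_assoc.
  rewrite (lsum_ext _ (fun q => (r q * (f (zsub p q) * g q)) ^ 2)
    (fun q => (w (zsub p q) * f (zsub p q) ^ 2) * (w q * g q ^ 2))).
  2: { intros q _; rewrite Rpow_mult_distr, Hr2; ring. }
  apply Rmult_le_compat_r.
  { apply lsum_nonneg; intros q _; apply Rmult_le_pos; (apply Rmult_le_pos; [left; apply Hw|apply pow2_ge_0]). }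
  rewrite <- lsum_scal.
  apply Rle_trans with (lsum (box d M) (fun q => 4 ^ s * (/ w q + / w (zsub p q)))).
  - apply lsum_le; intros q Hq.
    rewrite pow_inv, Hr2.
    pose proof (Hw q) as Hq1; pose proof (Hw (zsub p q)) as Hq2.
    apply (Rmult_le_reg_r (w (zsub p q) * w q)); [now apply Rmult_lt_0_compat|].
    rewrite Rmult_assoc, Rinv_l, Rmult_1_r by (apply Rgt_not_eq, Rmult_lt_0_compat; auto).
    replace (4 ^ s * (/ w q + / w (zsub p q)) * (w (zsub p q) * w q))
      with (4 ^ s * (w (zsub p q) + w q)) by (field; lra).
    apply weight_sub_le. apply box_length in Hp, Hq; congruence.
  - rewrite lsum_scal, lsum_plus.
    pose proof (weight_sum_le d s M Hs) as H1.
    pose proof (weight_sum_le d s (N + M) Hs) as H2.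
    assert (H3 : lsum (box d M) (fun q => / w (zsub p q)) <= weight_sum_bound d s).
    { eapply Rle_trans; [|exact H2].
      apply (lsum_box_shift_r d N M p (fun q => / w q)); auto.
      intros; left; apply Rinv_0_lt_compat, Hw. }
    unfold conv_sq_const. replace (2 * 4 ^ s * weight_sum_bound d s)
      with (4 ^ s * (weight_sum_bound d s + weight_sum_bound d s)) by ring.
    apply Rmult_le_compat_l; [apply pow_le; lra|]. unfold w in *; lra.
Qed.

(** The pointwise bound reduces the claim to [l^1 * l^1 -> l^1] for the weighted squares [F] and
    [G]. After exchanging the sums, the inner sum over [p] is a shifted box sum of [F], hence at
    most [m^2] for every [q]. *)
Lemma conv_partial_l2 d s f g m m' N M : (d < 2 * s)%nat -> l2w d s f m -> l2w d s g m' ->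
  lsum (box d N) (fun p => (1 + zsq p) ^ s * lsum (box d M) (fun q => f (zsub p q) * g q) ^ 2)
  <= (conv_const d s * m * m') ^ 2.
Proof.
  intros Hs [Hm [Hf HF]] [Hm' [Hg HG]].
  set (F := fun q => (1 + zsq q) ^ s * f q ^ 2) in *.
  set (G := fun q => (1 + zsq q) ^ s * g q ^ 2) in *.
  assert (HF0 : forall q, 0 <= F q).
  { intros; apply Rmult_le_pos; [left; apply weight_pos|apply pow2_ge_0]. }
  assert (HG0 : forall q, 0 <= G q).
  { intros; apply Rmult_le_pos; [left; apply weight_pos|apply pow2_ge_0]. }
  pose proof (conv_sq_const_nonneg d s) as HC.
  apply Rle_trans with (lsum (box d N) (fun p => conv_sq_const d s
                           * lsum (box d M) (fun q => F (zsub p q) * G q))).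
  { apply lsum_le; intros p Hp; apply (conv_partial_pointwise d s f g N M p Hs Hp). }
  rewrite lsum_scal, lsum_swap.
  apply Rle_trans with (conv_sq_const d s * (m ^ 2 * m' ^ 2)).
  - apply Rmult_le_compat_l; auto.
    apply Rle_trans with (lsum (box d M) (fun q => m ^ 2 * G q)).
    + apply lsum_le; intros q Hq.
      rewrite (lsum_ext _ _ (fun p => G q * F (zsub p q))) by (intros; ring).
      rewrite lsum_scal, Rmult_comm. apply Rmult_le_compat_r; auto.
      eapply Rle_trans; [apply lsum_box_shift_l; eauto|apply HF].
    + rewrite lsum_scal. apply Rmult_le_compat_l; [apply pow2_ge_0|apply HG].
  - unfold conv_const.
    replace (((1 + conv_sq_const d s) * m * m') ^ 2)
      with ((1 + conv_sq_const d s) ^ 2 * (m ^ 2 * m' ^ 2)) by ring.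
    apply Rmult_le_compat_r; [apply Rmult_le_pos; apply pow2_ge_0|nra].
Qed.

Definition conv (d : nat) (f g : list Z -> R) (p : list Z) : R :=
  real (Lim_seq (fun N => lsum (box d N) (fun q => f (zsub p q) * g q))).

(** Justifies the total definition by [Lim_seq]: the partial sums increase, and they are bounded
    because a single term of the weighted [l^2] estimate, of weight at least [1], already controls
    their squares. *)
Lemma conv_lim d s f g m m' p : (d < 2 * s)%nat -> l2w d s f m -> l2w d s g m' ->
  length p = d ->
  is_lim_seq (fun N => lsum (box d N) (fun q => f (zsub p q) * g q)) (conv d f g p).
Proof.
  intros Hs Hf Hg Hp.
  assert (Hpos : forall q, length q = d -> 0 <= f (zsub p q) * g q).
  { intros q Hq; apply Rmult_le_pos; [apply Hf; now apply length_zsub_eq|now apply Hg]. }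
  apply (Lim_seq_correct' (fun N => lsum (box d N) (fun q => f (zsub p q) * g q))).
  apply ex_finite_lim_seq_incr with (conv_const d s * m * m').
  - intros N; apply lsum_box_mono; [lia|auto].
  - intros M. destruct (exists_box d p Hp) as [N HN].
    pose proof (conv_partial_l2 d s f g m m' N M Hs Hf Hg) as H.
    assert (H' : lsum (box d M) (fun q => f (zsub p q) * g q) ^ 2
                 <= (conv_const d s * m * m') ^ 2).
    { eapply Rle_trans; [|exact H].
      eapply Rle_trans; [|apply (lsum_in _ _ p); [|exact HN]].
      - assert (1 <= (1 + zsq p) ^ s) by (apply pow_R1_Rle; pose proof (zsq_nonneg p); lra).
        pose proof (pow2_ge_0 (lsum (box d M) (fun q => f (zsub p q) * g q))); nra.
      - intros q _; apply Rmult_le_pos; [left; apply weight_pos|apply pow2_ge_0]. }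
    assert (0 <= conv_const d s * m * m').
    { pose proof (conv_sq_const_nonneg d s); repeat apply Rmult_le_pos; unfold conv_const;
        [lra|apply Hf|apply Hg]. }
    apply Rnot_lt_le; intro; nra.
Qed.

Lemma le_conv d s f g m m' p N : (d < 2 * s)%nat -> l2w d s f m -> l2w d s g m' ->
  length p = d -> lsum (box d N) (fun q => f (zsub p q) * g q) <= conv d f g p.
Proof.
  intros Hs Hf Hg Hp.
  apply (is_lim_seq_incr_compare (fun N => lsum (box d N) (fun q => f (zsub p q) * g q))).
  - now apply conv_lim with s m m'.
  - intros n; apply lsum_box_mono; [lia|].
    intros q Hq; apply Rmult_le_pos; [apply Hf; now apply length_zsub_eq|now apply Hg].
Qed.

(** The inner radius [M] tends to infinity while the outer box [N] stays fixed, so the limit is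
    exchanged only with a finite sum. *)
Lemma l2w_conv d s f g m m' : (d < 2 * s)%nat -> l2w d s f m -> l2w d s g m' ->
  l2w d s (conv d f g) (conv_const d s * m * m').
Proof.
  intros Hs Hf Hg; split; [|split].
  - pose proof (conv_sq_const_nonneg d s); repeat apply Rmult_le_pos; unfold conv_const;
      [lra|apply Hf|apply Hg].
  - intros p Hp. eapply Rle_trans; [|apply (le_conv d s f g m m' p 0 Hs Hf Hg Hp)].
    apply lsum_nonneg; intros q Hq; apply box_length in Hq.
    apply Rmult_le_pos; [apply Hf; now apply length_zsub_eq|now apply Hg].
  - intros N.
    assert (L : is_lim_seq (fun M => lsum (box d N) (fun p => (1 + zsq p) ^ s
        * lsum (box d M) (fun q => f (zsub p q) * g q) ^ 2))
        (lsum (box d N) (fun p => (1 + zsq p) ^ s * conv d f g p ^ 2))).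
    { apply is_lim_seq_lsum; intros p Hp; apply box_length in Hp.
      pose proof (conv_lim d s f g m m' p Hs Hf Hg Hp) as Hc.
      apply (is_lim_seq_scal_l _ _ (Finite (conv d f g p ^ 2))).
      apply is_lim_seq_ext with (fun M => lsum (box d M) (fun q => f (zsub p q) * g q)
         * lsum (box d M) (fun q => f (zsub p q) * g q)); [intros; ring|].
      replace (conv d f g p ^ 2) with (conv d f g p * conv d f g p) by ring.
      now apply is_lim_seq_mult'. }
    apply (is_lim_seq_le _ (fun _ => (conv_const d s * m * m') ^ 2) _ _
      (fun M => conv_partial_l2 d s f g m m' N M Hs Hf Hg) L (is_lim_seq_const _)).
Qed.

(** * Bounds for the complex lattice sums [zsum] *)

Lemma real_Lim_seq_bound (x : nat -> R) b :
  (forall n, Rabs (x n) <= b) -> Rabs (real (Lim_seq x)) <= b.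
Proof.
  intros H.
  assert (H1 : Rbar_le (Lim_seq x) b).
  { rewrite <- (Lim_seq_const b). apply Lim_seq_le_loc. exists 0%nat; intros n _.
    specialize (H n); apply Rabs_le_between in H; lra. }
  assert (H2 : Rbar_le (- b) (Lim_seq x)).
  { rewrite <- (Lim_seq_const (- b)). apply Lim_seq_le_loc. exists 0%nat; intros n _.
    specialize (H n); apply Rabs_le_between in H; lra. }
  destruct (Lim_seq x); simpl in *; try contradiction. apply Rabs_le_between; lra.
Qed.

Lemma fst_box_sumC d N g : fst (box_sumC d N g) = lsum (box d N) (fun p => fst (g p)).
Proof.
  unfold box_sumC, lsum; induction (box d N) as [|p l IH]; simpl; auto. now rewrite IH.
Qed.

Lemma snd_box_sumC d N g : snd (box_sumC d N g) = lsum (box d N) (fun p => snd (g p)).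
Proof.
  unfold box_sumC, lsum; induction (box d N) as [|p l IH]; simpl; auto. now rewrite IH.
Qed.

Lemma Rabs_lsum_le {A : Type} (l : list A) f : Rabs (lsum l f) <= lsum l (fun x => Rabs (f x)).
Proof.
  induction l as [|x l IH]; [unfold lsum; simpl; rewrite Rabs_R0; lra|].
  change (Rabs (f x + lsum l f) <= Rabs (f x) + lsum l (fun x => Rabs (f x))).
  eapply Rle_trans; [apply Rabs_triang|lra].
Qed.

(* No convergence is needed: [Lim_seq] is the mean of the upper and lower limits. *)
Lemma Cmod_zsum_le d g b : (forall N, lsum (box d N) (fun q => Cmod (g q)) <= b) ->
  Cmod (zsum d g) <= 2 * b.
Proof.
  intros H. eapply Rle_trans; [apply Cmod_le_abs|]. unfold zsum; simpl.
  assert (Rabs (real (Lim_seq (fun N => fst (box_sumC d N g)))) <= b).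
  { apply real_Lim_seq_bound; intros N; rewrite fst_box_sumC.
    eapply Rle_trans; [apply Rabs_lsum_le|]. eapply Rle_trans; [|apply (H N)].
    apply lsum_le; intros; apply Rabs_fst_le. }
  assert (Rabs (real (Lim_seq (fun N => snd (box_sumC d N g)))) <= b).
  { apply real_Lim_seq_bound; intros N; rewrite snd_box_sumC.
    eapply Rle_trans; [apply Rabs_lsum_le|]. eapply Rle_trans; [|apply (H N)].
    apply lsum_le; intros; apply Rabs_snd_le. }
  lra.
Qed.

(** The common pattern for all products in the recursion; the factor [2] accounts for estimating
    real and imaginary parts separately. *)
Lemma Cmod_zsum_conv_le d s f g m m' c (phi : list Z -> C) p : (d < 2 * s)%nat ->
  l2w d s f m -> l2w d s g m' -> length p = d -> 0 <= c ->
  (forall q, length q = d -> Cmod (phi q) <= c * (f (zsub p q) * g q)) ->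
  Cmod (zsum d phi) <= 2 * (c * conv d f g p).
Proof.
  intros Hs Hf Hg Hp Hc H. apply Cmod_zsum_le; intros N.
  apply Rle_trans with (lsum (box d N) (fun q => c * (f (zsub p q) * g q))).
  - apply lsum_le; intros q Hq; apply H; now apply box_length in Hq.
  - rewrite lsum_scal. apply Rmult_le_compat_l; auto. now apply le_conv with s m m'.
Qed.

(** * Comparison with the Sobolev norms *)

Lemma Hs_sum_nonneg (r : R) g p : 0 <= Rpower (1 + zsq p) r * Cmod (g p) ^ 2.
Proof. apply Rmult_le_pos; [left; apply exp_pos|apply pow2_ge_0]. Qed.

(** [in_Hs] only says that the value of [Lim_seq] is finite. Since the box sums increase, this value
    is a genuine limit and dominates each of them. *)
Lemma in_Hs_sum_le d r g N : in_Hs d r g ->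
  lsum (box d N) (fun p => Rpower (1 + zsq p) r * Cmod (g p) ^ 2) <= Hs_norm d r g ^ 2.
Proof.
  intros H. set (x := fun N => box_sumR d N (fun p => Rpower (1 + zsq p) r * Cmod (g p) ^ 2)).
  assert (Hincr : forall n, x n <= x (S n)).
  { intros n; apply (lsum_box_mono d n (S n)); [lia|]; intros; apply Hs_sum_nonneg. }
  assert (Hl : is_lim_seq x (real (Hs_sq d r g))).
  { rewrite H. apply Lim_seq_correct. now apply ex_lim_seq_incr. }
  pose proof (is_lim_seq_incr_compare x _ Hl Hincr) as Hle.
  assert (H0 : 0 <= x N) by (apply (lsum_nonneg (box d N)); intros; apply Hs_sum_nonneg).
  unfold Hs_norm. rewrite pow2_sqrt.
  - apply (Hle N).
  - specialize (Hle N); lra.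
Qed.

(** The factor [sqrt (1 + zsq p)] stands for one derivative and raises the exponent of the weight
    from [s] to [s + 1], which is where the extra order of regularity of the data is spent. *)
Lemma l2w_of_in_Hs d s r g c : in_Hs d r g -> INR s + 1 <= r -> 0 <= c ->
  l2w d s (fun p => c * sqrt (1 + zsq p) * Cmod (g p)) (c * Hs_norm d r g).
Proof.
  intros H Hr Hc.
  assert (L : l2w d s (fun p => sqrt (1 + zsq p) * Cmod (g p)) (Hs_norm d r g)).
  { split; [apply sqrt_pos|split].
    - intros; apply Rmult_le_pos; [apply sqrt_pos|apply Cmod_ge_0].
    - intros N; eapply Rle_trans; [|apply (in_Hs_sum_le d r g N H)].
      apply lsum_le; intros p _. pose proof (zsq_nonneg p).
      rewrite Rpow_mult_distr, pow2_sqrt, <- Rmult_assoc by lra.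
      apply Rmult_le_compat_r; [apply pow2_ge_0|].
      replace ((1 + zsq p) ^ s * (1 + zsq p)) with ((1 + zsq p) ^ (S s)) by (simpl; ring).
      rewrite <- Rpower_pow by lra. apply Rle_Rpower; [lra|]. rewrite S_INR; lra. }
  eapply l2w_le; [apply (l2w_scal d s c _ _ Hc L)|lra|].
  intros p _; simpl. pose proof (sqrt_pos (1 + zsq p)); pose proof (Cmod_ge_0 (g p)).
  split; [repeat apply Rmult_le_pos; auto|lra].
Qed.

Lemma in_Hs_of_l2w d s g m : l2w d s (fun p => Cmod (g p)) m ->
  in_Hs d (INR s) g /\ Hs_norm d (INR s) g <= m.
Proof.
  intros [Hm [_ H]].
  set (x := fun N => box_sumR d N (fun p => Rpower (1 + zsq p) (INR s) * Cmod (g p) ^ 2)).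
  assert (Hx : forall N, 0 <= x N <= m ^ 2).
  { intros N; split; [apply (lsum_nonneg (box d N)); intros; apply Hs_sum_nonneg|].
    eapply Rle_trans; [|apply (H N)]. apply (lsum_le (box d N)); intros p _.
    rewrite Rpower_pow by (pose proof (zsq_nonneg p); lra). lra. }
  assert (H1 : Rbar_le (Lim_seq x) (m ^ 2)).
  { rewrite <- (Lim_seq_const (m ^ 2)). apply Lim_seq_le_loc. exists 0%nat; intros n _; apply Hx. }
  assert (H2 : Rbar_le 0 (Lim_seq x)).
  { rewrite <- (Lim_seq_const 0). apply Lim_seq_le_loc. exists 0%nat; intros n _; apply Hx. }
  unfold in_Hs, Hs_norm, Hs_sq; fold x.
  destruct (Lim_seq x) as [l| |]; simpl in *; try contradiction.
  split; [reflexivity|]. rewrite <- (sqrt_pow2 m) by auto. now apply sqrt_le_1_alt.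
Qed.

Lemma Rle_0_2 : 0 <= 2.
Proof. lra. Qed.

(** * Bounds for the symbols and the source terms *)

Lemma Cmod_csum_le n f : Cmod (csum n f) <= lsum (seq 0 n) (fun j => Cmod (f j)).
Proof.
  unfold csum, lsum; induction (seq 0 n) as [|j l IH]; simpl.
  - rewrite Cmod_0; lra.
  - eapply Rle_trans; [apply Cmod_triangle|lra].
Qed.

Lemma Cmod_cdot_le n0 v w A B : 0 <= A ->
  (forall j, (j < n0)%nat -> Cmod (v j) <= A) -> (forall j, (j < n0)%nat -> Cmod (w j) <= B) ->
  Cmod (cdot n0 v w) <= INR n0 * (A * B).
Proof.
  intros HA Hv Hw. unfold cdot. eapply Rle_trans; [apply Cmod_csum_le|].
  rewrite <- (length_seq n0 0) at 2. rewrite <- lsum_const.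
  apply lsum_le; intros j Hj; apply in_seq in Hj. rewrite Cmod_mult.
  apply Rmult_le_compat; try apply Cmod_ge_0; [apply Hv|apply Hw]; lia.
Qed.

Lemma Rabs_nth_le p i : Rabs (IZR (nth i p 0%Z)) <= sqrt (1 + zsq p).
Proof.
  rewrite <- sqrt_Rsqr_abs. apply sqrt_le_1_alt. unfold Rsqr.
  pose proof (zsq_nonneg p).
  destruct (Nat.lt_ge_cases i (length p)) as [Hi|Hi].
  - pose proof (lsum_in p (fun z => IZR z ^ 2) (nth i p 0%Z) (fun z _ => pow2_ge_0 (IZR z)) (nth_In p 0%Z Hi)) as H1.
    change (lsum p (fun z => IZR z ^ 2)) with (zsq p) in H1. nra.
  - rewrite nth_overflow by assumption. lra.
Qed.

(** The entrywise [l^1] norm of [K] dominates the operator norm. The added [1] lets one multiple of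
    [sqrt (1 + zsq p) * Cmod (fh p)] bound both [f] and [K^T grad f]. *)
Definition ksize (d n0 : nat) (K : nat -> nat -> R) : R :=
  1 + lsum (seq 0 n0) (fun j => lsum (seq 0 d) (fun i => Rabs (K i j))).

Lemma ksize_ge1 d n0 K : 1 <= ksize d n0 K.
Proof.
  assert (0 <= lsum (seq 0 n0) (fun j => lsum (seq 0 d) (fun i => Rabs (K i j)))).
  { apply lsum_nonneg; intros; apply lsum_nonneg; intros; apply Rabs_pos. }
  unfold ksize; lra.
Qed.

Lemma Rabs_kt_le d K p j :
  Rabs (kt d K p j) <= lsum (seq 0 d) (fun i => Rabs (K i j)) * sqrt (1 + zsq p).
Proof.
  unfold kt. change (rsum d) with (lsum (seq 0 d)).
  eapply Rle_trans; [apply Rabs_lsum_le|].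
  rewrite Rmult_comm, <- lsum_scal. apply lsum_le; intros i _.
  rewrite Rabs_mult, Rmult_comm. apply Rmult_le_compat_r; [apply Rabs_pos|apply Rabs_nth_le].
Qed.

Lemma k2_nonneg d n0 K p : 0 <= k2 d n0 K p.
Proof. apply (lsum_nonneg (seq 0 n0)); intros; apply pow2_ge_0. Qed.

Lemma knorm_sq d n0 K p : knorm d n0 K p ^ 2 = k2 d n0 K p.
Proof. apply pow2_sqrt, k2_nonneg. Qed.

Lemma knorm_nonneg d n0 K p : 0 <= knorm d n0 K p.
Proof. apply sqrt_pos. Qed.

Lemma lsum_sq_le {A : Type} (l : list A) f : (forall x, 0 <= f x) ->
  lsum l (fun x => f x ^ 2) <= lsum l f ^ 2.
Proof.
  intros Hf; induction l as [|x l IH]; [unfold lsum; simpl; lra|].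
  change (f x ^ 2 + lsum l (fun x => f x ^ 2) <= (f x + lsum l f) ^ 2).
  assert (0 <= lsum l f) by (apply lsum_nonneg; auto). specialize (Hf x); nra.
Qed.

Lemma knorm_le d n0 K p : knorm d n0 K p <= ksize d n0 K * sqrt (1 + zsq p).
Proof.
  apply Rle_trans with (lsum (seq 0 n0) (fun j => Rabs (kt d K p j))).
  - unfold knorm. assert (0 <= lsum (seq 0 n0) (fun j => Rabs (kt d K p j))).
    { apply lsum_nonneg; intros; apply Rabs_pos. }
    rewrite <- (sqrt_pow2 (lsum _ _)) by assumption. apply sqrt_le_1_alt.
    eapply Rle_trans; [|apply lsum_sq_le; intros; apply Rabs_pos].
    right. apply (lsum_ext (seq 0 n0)); intros; now rewrite pow2_abs.
  - apply Rle_trans with (lsum (seq 0 n0) (fun j => sqrt (1 + zsq p) * lsum (seq 0 d) (fun i => Rabs (K i j)))).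
    + apply lsum_le; intros; rewrite Rmult_comm; apply Rabs_kt_le.
    + rewrite lsum_scal, Rmult_comm. unfold ksize.
      pose proof (sqrt_pos (1 + zsq p)). nra.
Qed.

Lemma Cmod_ik_le d n0 K p j : (j < n0)%nat -> Cmod (ik d K p j) <= knorm d n0 K p.
Proof.
  intros Hj. unfold ik, Cmod, knorm; simpl fst; simpl snd.
  apply sqrt_le_1_alt. replace (0 ^ 2 + kt d K p j ^ 2) with (kt d K p j ^ 2) by ring.
  apply (lsum_in (seq 0 n0) (fun j => kt d K p j ^ 2)).
  - intros; apply pow2_ge_0.
  - apply in_seq; lia.
Qed.

Lemma tanh_bounds x : 0 <= x -> 0 <= Defs.tanh x <= 1.
Proof.
  intros Hx. unfold Defs.tanh. pose proof (exp_pos x); pose proof (exp_pos (- x)).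
  assert (exp (- x) <= exp x).
  { destruct (Req_dec x 0) as [->|]; [rewrite Ropp_0; lra|left; apply exp_increasing; lra]. }
  split.
  - apply Rmult_le_pos; [lra|left; apply Rinv_0_lt_compat; lra].
  - apply (Rmult_le_reg_r (exp x + exp (- x))); [lra|].
    unfold Rdiv; rewrite Rmult_assoc, Rinv_l; lra.
Qed.

(** All that is used of [T~], for finite and infinite depth alike: the sign and size control the
    reflection in [bvp_bound], and the size controls [J]. The assumption [a < h] also excludes
    [m_infty], which the default branch of [tau] treats like infinite depth. *)
Lemma tau_bounds d n0 K (a : R) h p : Rbar_lt a h -> 0 <= tau d n0 K a h p <= knorm d n0 K p.
Proof.
  intros Hh; pose proof (knorm_nonneg d n0 K p) as Hk.
  destruct h as [hh| |]; [|unfold tau; lra|contradiction Hh].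
  simpl in Hh; unfold tau.
  assert (H : 0 <= (hh - a) * knorm d n0 K p) by (apply Rmult_le_pos; lra).
  apply tanh_bounds in H; split; [now apply Rmult_le_pos|].
  rewrite <- (Rmult_1_r (knorm d n0 K p)) at 3. now apply Rmult_le_compat_l.
Qed.

Lemma Cmod_RtoC_pos x : 0 <= x -> Cmod (RtoC x) = x.
Proof. intros; rewrite Cmod_R, Rabs_pos_eq; auto. Qed.

Section Sources.
Context (d n0 : nat) (K : nat -> nat -> R) (a : R) (h : Rbar) (s : nat) (fh : list Z -> C).
Context (Ha : 0 < a) (Hh : Rbar_lt (Finite a) h) (Hs : (d < 2 * s)%nat).
Context (phi : list Z -> R) (mf : R) (Hphi : l2w d s phi mf).
Context (Hf0 : forall p, Cmod (fh p) <= phi p).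
Context (Hf1 : forall p, knorm d n0 K p * Cmod (fh p) <= phi p).

(** The sup norm in [y] is encoded by any upper bound [M q] valid for all [y], so no supremum has to
    be formed. The closed interval includes both traces. *)
Definition majorizes (U dU : list Z -> R -> C) (M : list Z -> R) : Prop :=
  forall q, length q = d -> forall y, - a <= y <= 0 ->
    knorm d n0 K q * Cmod (U q y) <= M q /\ Cmod (dU q y) <= M q.

Lemma Cmod_ik_fh_le p j : (j < n0)%nat -> Cmod (ik d K p j) * Cmod (fh p) <= phi p.
Proof.
  intros Hj; eapply Rle_trans; [|apply Hf1].
  apply Rmult_le_compat_r; [apply Cmod_ge_0|now apply Cmod_ik_le].
Qed.

(** One majorant, up to constants, for the coefficients of [f^2], [f K^T grad f] and
    [|K^T grad f|^2]. *)
Let ff := conv d phi phi.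

Lemma l2w_ff : l2w d s ff (conv_const d s * mf * mf).
Proof. now apply l2w_conv. Qed.

Lemma Cmod_fsq_le m : length m = d -> Cmod (fsq d fh m) <= 2 * ff m.
Proof.
  intros Hm. eapply Rle_trans.
  - apply (Cmod_zsum_conv_le d s phi phi mf mf 1 _ m); auto using Rle_0_1, Rle_0_2. intros q _.
    rewrite Cmod_mult, Rmult_1_l. apply Rmult_le_compat; try apply Cmod_ge_0; auto.
  - unfold ff; lra.
Qed.

Lemma Cmod_fgradf_le m j : length m = d -> (j < n0)%nat -> Cmod (fgradf d K fh m j) <= 2 * ff m.
Proof.
  intros Hm Hj. eapply Rle_trans.
  - apply (Cmod_zsum_conv_le d s phi phi mf mf 1 _ m); auto using Rle_0_1, Rle_0_2. intros q _.
    rewrite !Cmod_mult, Rmult_1_l.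
    apply Rmult_le_compat; try apply Cmod_ge_0; auto.
    + apply Rmult_le_pos; apply Cmod_ge_0.
    + now apply Cmod_ik_fh_le.
  - unfold ff; lra.
Qed.

Lemma Cmod_cdot_ik_le p q :
  Cmod (cdot n0 (ik d K p) (ik d K q)) <= INR n0 * (knorm d n0 K p * knorm d n0 K q).
Proof. apply Cmod_cdot_le; [apply knorm_nonneg| |]; intros; now apply Cmod_ik_le. Qed.

Lemma Cmod_gradf2_le m : length m = d -> Cmod (gradf2 d n0 K fh m) <= 2 * (INR n0 * ff m).
Proof.
  intros Hm. apply (Cmod_zsum_conv_le d s phi phi mf mf (INR n0)); auto using pos_INR.
  intros q _. rewrite !Cmod_mult.
  pose proof (Cmod_ge_0 (fh q)); pose proof (Cmod_ge_0 (fh (zsub m q))).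
  apply Rle_trans with (INR n0 * (knorm d n0 K (zsub m q) * knorm d n0 K q)
                        * Cmod (fh (zsub m q)) * Cmod (fh q)).
  - do 2 (apply Rmult_le_compat_r; auto). apply Cmod_cdot_ik_le.
  - replace (INR n0 * (knorm d n0 K (zsub m q) * knorm d n0 K q) * Cmod (fh (zsub m q)) * Cmod (fh q))
      with (INR n0 * ((knorm d n0 K (zsub m q) * Cmod (fh (zsub m q))) * (knorm d n0 K q * Cmod (fh q)))) by ring.
    apply Rmult_le_compat_l; [apply pos_INR|].
    apply Rmult_le_compat; auto; apply Rmult_le_pos; auto; apply knorm_nonneg.
Qed.

Context (U1 dU1 U2 dU2 : list Z -> R -> C) (M1 M2 : list Z -> R) (m1 m2 : R).
Context (HU1 : majorizes U1 dU1 M1) (HU2 : majorizes U2 dU2 M2).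
Context (HM1 : l2w d s M1 m1) (HM2 : l2w d s M2 m2).

(** [N1] bounds every term linear in [f] (index [n - 1]), and [N2] every term quadratic in [f]
    (index [n - 2]), up to constants. *)
Let N1 := conv d phi M1.
Let N2 := conv d ff M2.

Context (p : list Z) (y : R) (Hp : length p = d) (Hy : - a <= y <= 0).

Lemma conv_phi_nonneg : 0 <= N1 p.
Proof. apply (l2w_conv d s phi M1 mf m1 Hs Hphi HM1); auto. Qed.

Lemma conv_ff_nonneg : 0 <= N2 p.
Proof. apply (l2w_conv d s ff M2 _ m2 Hs l2w_ff HM2); auto. Qed.

Lemma zsum_f_gradu_le j : (j < n0)%nat ->
  Cmod (zsum d (fun q => fh (zsub p q) * ik d K q j * U1 q y)%C) <= 2 * N1 p.
Proof.
  intros Hj. replace (2 * N1 p) with (2 * (1 * N1 p)) by ring.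
  apply (Cmod_zsum_conv_le d s phi M1 mf m1); auto using Rle_0_1, Rle_0_2. intros q Hq.
  rewrite !Cmod_mult, Rmult_1_l, Rmult_assoc.
  apply Rmult_le_compat; try apply Cmod_ge_0; auto.
  - apply Rmult_le_pos; apply Cmod_ge_0.
  - eapply Rle_trans; [|apply (proj1 (HU1 q Hq y Hy))].
    apply Rmult_le_compat_r; [apply Cmod_ge_0|now apply Cmod_ik_le].
Qed.

Lemma zsum_gradf_du_le j : (j < n0)%nat ->
  Cmod (zsum d (fun q => ik d K (zsub p q) j * fh (zsub p q) * dU1 q y)%C) <= 2 * N1 p.
Proof.
  intros Hj. replace (2 * N1 p) with (2 * (1 * N1 p)) by ring.
  apply (Cmod_zsum_conv_le d s phi M1 mf m1); auto using Rle_0_1, Rle_0_2. intros q Hq.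
  rewrite !Cmod_mult, Rmult_1_l.
  apply Rmult_le_compat; try apply Cmod_ge_0.
  - apply Rmult_le_pos; apply Cmod_ge_0.
  - now apply Cmod_ik_fh_le.
  - apply (HU1 q Hq y Hy).
Qed.

(** One factor [2] comes from the lattice sum inside [fsq], the other from the outer one. *)
Lemma zsum_fsq_gradu_le j : (j < n0)%nat ->
  Cmod (zsum d (fun q => fsq d fh (zsub p q) * ik d K q j * U2 q y)%C) <= 2 * (2 * N2 p).
Proof.
  intros Hj.
  apply (Cmod_zsum_conv_le d s ff M2 _ m2 2 _ p Hs l2w_ff); auto using Rle_0_1, Rle_0_2. intros q Hq.
  rewrite !Cmod_mult, Rmult_assoc, <- (Rmult_assoc 2).
  apply Rmult_le_compat; try apply Cmod_ge_0.
  - apply Rmult_le_pos; apply Cmod_ge_0.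
  - apply Cmod_fsq_le; now apply length_zsub_eq.
  - eapply Rle_trans; [|apply (proj1 (HU2 q Hq y Hy))].
    apply Rmult_le_compat_r; [apply Cmod_ge_0|now apply Cmod_ik_le].
Qed.

Lemma zsum_fgradf_du_le j : (j < n0)%nat ->
  Cmod (zsum d (fun q => fgradf d K fh (zsub p q) j * dU2 q y)%C) <= 2 * (2 * N2 p).
Proof.
  intros Hj.
  apply (Cmod_zsum_conv_le d s ff M2 _ m2 2 _ p Hs l2w_ff); auto using Rle_0_1, Rle_0_2. intros q Hq.
  rewrite !Cmod_mult, <- (Rmult_assoc 2).
  apply Rmult_le_compat; try apply Cmod_ge_0.
  - apply Cmod_fgradf_le; auto; now apply length_zsub_eq.
  - apply (HU2 q Hq y Hy).
Qed.

Lemma zsum_gradf_gradu_le :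
  Cmod (zsum d (fun q => cdot n0 (ik d K (zsub p q)) (ik d K q) * fh (zsub p q) * U1 q y)%C)
  <= 2 * (INR n0 * N1 p).
Proof.
  apply (Cmod_zsum_conv_le d s phi M1 mf m1); auto using pos_INR. intros q Hq.
  rewrite !Cmod_mult.
  pose proof (Cmod_ge_0 (U1 q y)); pose proof (Cmod_ge_0 (fh (zsub p q))).
  apply Rle_trans with (INR n0 * (knorm d n0 K (zsub p q) * knorm d n0 K q)
                        * Cmod (fh (zsub p q)) * Cmod (U1 q y)).
  - do 2 (apply Rmult_le_compat_r; auto). apply Cmod_cdot_ik_le.
  - replace (INR n0 * (knorm d n0 K (zsub p q) * knorm d n0 K q) * Cmod (fh (zsub p q)) * Cmod (U1 q y))
      with (INR n0 * ((knorm d n0 K (zsub p q) * Cmod (fh (zsub p q))) * (knorm d n0 K q * Cmod (U1 q y)))) by ring.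
    apply Rmult_le_compat_l; [apply pos_INR|].
    apply Rmult_le_compat; auto; try (apply Rmult_le_pos; auto; apply knorm_nonneg).
    apply (HU1 q Hq y Hy).
Qed.

Lemma zsum_fgradf_gradu_le :
  Cmod (zsum d (fun q => cdot n0 (fgradf d K fh (zsub p q)) (ik d K q) * U2 q y)%C)
  <= 2 * (2 * INR n0 * N2 p).
Proof.
  apply (Cmod_zsum_conv_le d s ff M2 _ m2 (2 * INR n0) _ p Hs l2w_ff); auto.
  { pose proof (pos_INR n0); lra. }
  intros q Hq. rewrite !Cmod_mult.
  assert (Hl : length (zsub p q) = d) by now apply length_zsub_eq.
  assert (Hff : 0 <= ff (zsub p q)) by (apply l2w_ff; auto).
  pose proof (Cmod_ge_0 (U2 q y)).
  apply Rle_trans with (INR n0 * ((2 * ff (zsub p q)) * knorm d n0 K q) * Cmod (U2 q y)).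
  - apply Rmult_le_compat_r; auto. apply Cmod_cdot_le; [lra| |]; intros.
    + now apply Cmod_fgradf_le.
    + now apply Cmod_ik_le.
  - replace (INR n0 * (2 * ff (zsub p q) * knorm d n0 K q) * Cmod (U2 q y))
      with (2 * INR n0 * (ff (zsub p q) * (knorm d n0 K q * Cmod (U2 q y)))) by ring.
    apply Rmult_le_compat_l; [pose proof (pos_INR n0); lra|].
    apply Rmult_le_compat_l; auto. apply (HU2 q Hq y Hy).
Qed.

Lemma zsum_gradf2_du_le :
  Cmod (zsum d (fun q => gradf2 d n0 K fh (zsub p q) * dU2 q y)%C) <= 2 * (2 * INR n0 * N2 p).
Proof.
  apply (Cmod_zsum_conv_le d s ff M2 _ m2 (2 * INR n0) _ p Hs l2w_ff); auto.
  { pose proof (pos_INR n0); lra. }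
  intros q Hq. rewrite !Cmod_mult, <- (Rmult_assoc (2 * INR n0)).
  apply Rmult_le_compat; try apply Cmod_ge_0.
  - rewrite (Rmult_assoc 2). apply Cmod_gradf2_le. now apply length_zsub_eq.
  - apply (HU2 q Hq y Hy).
Qed.

Lemma zsum_f_tau_le :
  Cmod (zsum d (fun q => fh (zsub p q) * RtoC (tau d n0 K a h q) * U1 q (- a)%R)%C) <= 2 * N1 p.
Proof.
  replace (2 * N1 p) with (2 * (1 * N1 p)) by ring.
  apply (Cmod_zsum_conv_le d s phi M1 mf m1); auto using Rle_0_1, Rle_0_2. intros q Hq.
  pose proof (tau_bounds d n0 K a h q Hh) as Ht.
  rewrite !Cmod_mult, Rmult_1_l, Rmult_assoc, Cmod_RtoC_pos by apply Ht.
  apply Rmult_le_compat; try apply Cmod_ge_0; auto.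
  - apply Rmult_le_pos; [apply Ht|apply Cmod_ge_0].
  - eapply Rle_trans; [|apply (proj1 (HU1 q Hq (- a) ltac:(lra)))].
    apply Rmult_le_compat_r; [apply Cmod_ge_0|apply Ht].
Qed.

(** A deliberately crude common constant for [F^alpha], [F^0], [J] and [F^y / (a + y)]: [(1 + a)^2]
    absorbs all coefficients [1], [a], [a^2] that arise from [0 <= a + y <= a], and [1 + n0] the
    scalar products. *)
Definition source_const : R := / a ^ 2 * (4 * (1 + INR n0) * (1 + a) ^ 2).

Lemma inv_a2_pos : 0 < / a ^ 2.
Proof. apply Rinv_0_lt_compat, pow_lt, Ha. Qed.

Lemma source_const_nonneg : 0 <= source_const.
Proof.
  unfold source_const. pose proof inv_a2_pos; pose proof (pos_INR n0).
  apply Rmult_le_pos; [lra|]. apply Rmult_le_pos; [lra|apply pow2_ge_0].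
Qed.

Lemma Cmod_Falpha_le j : (j < n0)%nat ->
  Cmod (Falpha d K a fh U1 dU1 U2 dU2 p y j) <= source_const * (N1 p + N2 p).
Proof.
  intros Hj. unfold Falpha, source_const. pose proof inv_a2_pos as Hi.
  pose proof (pos_INR n0) as Hn. pose proof conv_phi_nonneg; pose proof conv_ff_nonneg.
  rewrite Cmod_mult, Cmod_RtoC_pos, Rmult_assoc by lra.
  apply Rmult_le_compat_l; [lra|].
  pose proof (zsum_f_gradu_le j Hj) as Z1. pose proof (zsum_gradf_du_le j Hj) as Z2.
  pose proof (zsum_fsq_gradu_le j Hj) as Z3. pose proof (zsum_fgradf_du_le j Hj) as Z4.
  set (z1 := zsum d (fun q => fh (zsub p q) * ik d K q j * U1 q y)%C) in *.
  set (z2 := zsum d (fun q => ik d K (zsub p q) j * fh (zsub p q) * dU1 q y)%C) in *.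
  set (z3 := zsum d (fun q => fsq d fh (zsub p q) * ik d K q j * U2 q y)%C) in *.
  set (z4 := zsum d (fun q => fgradf d K fh (zsub p q) j * dU2 q y)%C) in *.
  assert (Cmod (RtoC (- (2 * a)) * z1)%C <= 4 * a * N1 p).
  { rewrite Cmod_mult, Cmod_R, Rabs_Ropp, Rabs_pos_eq by lra.
    apply Rle_trans with (2 * a * (2 * N1 p)); [apply Rmult_le_compat_l; lra|lra]. }
  assert (Cmod (RtoC (a * (a + y)) * z2)%C <= 2 * a * a * N1 p).
  { rewrite Cmod_mult, Cmod_RtoC_pos by (apply Rmult_le_pos; lra).
    apply Rle_trans with (a * a * (2 * N1 p)); [|lra].
    apply Rmult_le_compat; try apply Cmod_ge_0; auto; try (apply Rmult_le_pos; lra).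
    apply Rmult_le_compat_l; lra. }
  assert (Cmod (RtoC (a + y) * z4)%C <= 4 * a * N2 p).
  { rewrite Cmod_mult, Cmod_RtoC_pos by lra.
    apply Rle_trans with (a * (2 * (2 * N2 p))); [|lra].
    apply Rmult_le_compat; try apply Cmod_ge_0; auto; lra. }
  eapply Rle_trans; [apply Cmod_triangle|].
  eapply Rle_trans; [apply Rplus_le_compat_r; unfold Cminus; apply Cmod_triangle|].
  rewrite Cmod_opp.
  eapply Rle_trans; [apply Rplus_le_compat_r, Rplus_le_compat_r, Cmod_triangle|].
  assert (0 <= (INR n0 + INR n0 * (2 * a) + INR n0 * a ^ 2) * (N1 p + N2 p)).
  { apply Rmult_le_pos; [|lra]. pose proof (pow2_ge_0 a).
    assert (0 <= INR n0 * (2 * a)) by (apply Rmult_le_pos; lra).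
    assert (0 <= INR n0 * a ^ 2) by (apply Rmult_le_pos; lra). lra. }
  assert (0 <= a * N1 p) by (apply Rmult_le_pos; lra).
  assert (0 <= a * N2 p) by (apply Rmult_le_pos; lra).
  assert (0 <= a * a * N1 p) by (repeat apply Rmult_le_pos; lra).
  assert (0 <= a * a * N2 p) by (repeat apply Rmult_le_pos; lra).
  lra.
Qed.

(* The common bracket of [F^y] and [F^0]. *)
Lemma Cmod_bracket_le (c1 c2 c3 : R) (z1 z2 z3 : C) :
  0 <= c1 <= a -> 0 <= c2 <= 1 -> 0 <= c3 <= a ->
  Cmod z1 <= 2 * (INR n0 * N1 p) -> Cmod z2 <= 2 * (2 * INR n0 * N2 p) ->
  Cmod z3 <= 2 * (2 * INR n0 * N2 p) ->
  Cmod (RtoC c1 * z1 + RtoC c2 * z2 - RtoC c3 * z3)%C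
    <= 4 * (1 + INR n0) * (1 + a) ^ 2 * (N1 p + N2 p).
Proof.
  intros H1 H2 H3 Z1 Z2 Z3.
  pose proof (pos_INR n0) as Hn. pose proof conv_phi_nonneg as HN1; pose proof conv_ff_nonneg as HN2.
  eapply Rle_trans; [unfold Cminus; apply Cmod_triangle|]. rewrite Cmod_opp.
  eapply Rle_trans; [apply Rplus_le_compat_r, Cmod_triangle|].
  rewrite !Cmod_mult, !Cmod_RtoC_pos by lra.
  assert (c1 * Cmod z1 <= a * (2 * (INR n0 * N1 p))).
  { apply Rmult_le_compat; try apply Cmod_ge_0; lra. }
  assert (c2 * Cmod z2 <= 1 * (2 * (2 * INR n0 * N2 p))).
  { apply Rmult_le_compat; try apply Cmod_ge_0; lra. }
  assert (c3 * Cmod z3 <= a * (2 * (2 * INR n0 * N2 p))).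
  { apply Rmult_le_compat; try apply Cmod_ge_0; lra. }
  assert (0 <= INR n0 * N1 p) by (apply Rmult_le_pos; lra).
  assert (0 <= INR n0 * N2 p) by (apply Rmult_le_pos; lra).
  assert (0 <= a * (INR n0 * N1 p)) by (apply Rmult_le_pos; lra).
  assert (0 <= a * (INR n0 * N2 p)) by (apply Rmult_le_pos; lra).
  assert (0 <= a * (a * (INR n0 * N1 p))) by (apply Rmult_le_pos; lra).
  assert (0 <= a * (a * (INR n0 * N2 p))) by (apply Rmult_le_pos; lra).
  assert (0 <= (1 + a) ^ 2 * (N1 p + N2 p)) by (apply Rmult_le_pos; [apply pow2_ge_0|lra]).
  lra.
Qed.

Lemma Cmod_F0_le :
  Cmod (F0 d n0 K a fh U1 U2 dU2 p y) <= source_const * (N1 p + N2 p).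
Proof.
  unfold F0, source_const. pose proof inv_a2_pos as Hi.
  rewrite Cmod_mult, Cmod_RtoC_pos, Rmult_assoc by lra.
  apply Rmult_le_compat_l; [lra|].
  pose proof (Cmod_bracket_le a 1 (a + y) _ _ _ ltac:(lra) ltac:(lra) ltac:(lra)
    zsum_gradf_gradu_le zsum_fgradf_gradu_le zsum_gradf2_du_le) as H.
  rewrite Cmult_1_l in H. exact H.
Qed.

(** [F^y] is [a + y] times the bracket that forms [F^0]. Keeping this factor, which vanishes at
    [y = -a], is what [bvp_bound_complex] requires. *)
Lemma Cmod_Fy_le :
  Cmod (Fy d n0 K a fh U1 U2 dU2 p y) <= (a + y) * (source_const * (N1 p + N2 p)).
Proof.
  unfold Fy, source_const. pose proof inv_a2_pos as Hi.
  pose proof (Cmod_bracket_le a 1 (a + y) _ _ _ ltac:(lra) ltac:(lra) ltac:(lra)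
    zsum_gradf_gradu_le zsum_fgradf_gradu_le zsum_gradf2_du_le) as H.
  set (z1 := zsum d (fun q => cdot n0 (ik d K (zsub p q)) (ik d K q) * fh (zsub p q) * U1 q y)%C) in *.
  set (z2 := zsum d (fun q => cdot n0 (fgradf d K fh (zsub p q)) (ik d K q) * U2 q y)%C) in *.
  set (z3 := zsum d (fun q => gradf2 d n0 K fh (zsub p q) * dU2 q y)%C) in *.
  replace (RtoC (/ a ^ 2) * (RtoC (a * (a + y)) * z1 + RtoC (a + y) * z2
                             - RtoC ((a + y) ^ 2) * z3))%C
    with (RtoC (a + y) * (RtoC (/ a ^ 2)
            * (RtoC a * z1 + RtoC 1 * z2 - RtoC (a + y) * z3)))%C.
  - rewrite !Cmod_mult, !Cmod_RtoC_pos by lra.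
    apply Rmult_le_compat_l; [lra|]. rewrite Rmult_assoc. apply Rmult_le_compat_l; lra.
  - replace ((a + y) ^ 2) with ((a + y) * (a + y)) by ring. rewrite !RtoC_mult. ring.
Qed.

Lemma Cmod_Jn_le :
  Cmod (Jn d n0 K a h fh U1 p) <= source_const * (N1 p + N2 p).
Proof.
  unfold Jn, source_const. pose proof inv_a2_pos as Hi.
  assert (Hia : 0 < / a) by now apply Rinv_0_lt_compat.
  rewrite Cmod_mult, Cmod_RtoC_pos by lra.
  replace (/ a) with (/ a ^ 2 * a) by (field; lra).
  rewrite !Rmult_assoc. apply Rmult_le_compat_l; [lra|].
  pose proof (pos_INR n0) as Hn. pose proof conv_phi_nonneg; pose proof conv_ff_nonneg.
  apply Rle_trans with (a * (2 * N1 p)); [apply Rmult_le_compat_l; [lra|apply zsum_f_tau_le]|].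
  assert (0 <= a * N1 p) by (apply Rmult_le_pos; lra).
  assert (0 <= a * N2 p) by (apply Rmult_le_pos; lra).
  assert (0 <= a * a * N1 p) by (repeat apply Rmult_le_pos; lra).
  assert (0 <= a * a * N2 p) by (repeat apply Rmult_le_pos; lra).
  assert (0 <= INR n0 * ((1 + a) ^ 2 * (N1 p + N2 p))).
  { apply Rmult_le_pos; auto; apply Rmult_le_pos; [apply pow2_ge_0|lra]. }
  lra.
Qed.

End Sources.

(** * The recursion *)

(** The first summand serves the Dirichlet datum; in the second, [1 + 2 a + n0] collects [J], then
    [F^y] and [F^0] with weight [a] each, then [F^alpha]; the third serves the products in
    [Gstep]. *)
Definition step_const (n0 : nat) (a : R) : R :=
  10 + 10 * (1 + 2 * a + INR n0) * source_const n0 a + 4 * (1 + INR n0) * (1 + / a).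

Lemma step_const_bounds n0 a : 0 < a ->
  10 + 10 * (1 + 2 * a + INR n0) * source_const n0 a <= step_const n0 a /\
  4 * (1 + INR n0) * (1 + / a) <= step_const n0 a.
Proof.
  intros Ha. pose proof (source_const_nonneg n0 a Ha) as Hc. pose proof (pos_INR n0).
  assert (0 < / a) by now apply Rinv_0_lt_compat.
  assert (0 <= 10 * (1 + 2 * a + INR n0) * source_const n0 a) by (apply Rmult_le_pos; lra).
  assert (0 <= 4 * (1 + INR n0) * (1 + / a)) by (apply Rmult_le_pos; lra).
  unfold step_const; lra.
Qed.

Lemma step_const_ge1 n0 a : 0 < a -> 1 <= step_const n0 a.
Proof.
  intros Ha. destruct (step_const_bounds n0 a Ha) as [H _].
  pose proof (source_const_nonneg n0 a Ha). pose proof (pos_INR n0).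
  assert (0 <= 10 * (1 + 2 * a + INR n0) * source_const n0 a) by (apply Rmult_le_pos; lra).
  lra.
Qed.

Section Recursion.
Context (d n0 : nat) (K : nat -> nat -> R) (a : R) (h : Rbar) (s : nat) (fh xih : list Z -> C).
Context (u du : nat -> list Z -> R -> C).
Context (Ha : 0 < a) (Hh : Rbar_lt (Finite a) h) (Hs : (d < 2 * s)%nat).
Context (Hsol : solves_rec d n0 K a h fh xih u du).
Context (phi : list Z -> R) (mf : R) (Hphi : l2w d s phi mf).
Context (Hf0 : forall p, Cmod (fh p) <= phi p).
Context (Hf1 : forall p, knorm d n0 K p * Cmod (fh p) <= phi p).

Definition dirichlet (n : nat) (p : list Z) : R :=
  match n with O => knorm d n0 K p * Cmod (xih p) | S _ => 0 end.

Definition next_major (M1 M2 : list Z -> R) (n : nat) (p : list Z) : R :=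
  step_const n0 a * (dirichlet n p + conv d phi M1 p + conv d (conv d phi phi) M2 p).

(** The two-point bound mode by mode, with [P1 = T] for [F^y], [P2 = n0 T] for [F^alpha] and [D = T]
    for [F^0]. The divergence of [F^alpha] carries a factor [k], matching the term [k * P2] that the
    damping absorbs. *)
Lemma majorizes_next n M1 M2 m1 m2 :
  majorizes d n0 K a (sh1 u n) (sh1 du n) M1 -> majorizes d n0 K a (sh2 u n) (sh2 du n) M2 ->
  l2w d s M1 m1 -> l2w d s M2 m2 ->
  majorizes d n0 K a (u n) (du n) (next_major M1 M2 n).
Proof.
  intros HU1 HU2 HM1 HM2 p Hp.
  destruct (Hsol n p Hp) as [Hd [Heq [H0 HJ]]].
  pose proof (conv_phi_nonneg d s Hs phi mf Hphi M1 m1 HM1 p Hp) as HN1.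
  pose proof (conv_ff_nonneg d s Hs phi mf Hphi M2 m2 HM2 p Hp) as HN2.
  pose proof (source_const_nonneg n0 a Ha) as Hc. pose proof (pos_INR n0) as Hn.
  pose proof (knorm_nonneg d n0 K p) as Hk.
  set (T := source_const n0 a * (conv d phi M1 p + conv d (conv d phi phi) M2 p)) in *.
  assert (HT : 0 <= T) by (apply Rmult_le_pos; lra).
  pose proof (bvp_bound_complex (u n p) (du n p)
    (Fy d n0 K a fh (sh1 u n) (sh2 u n) (sh2 du n) p)
    (fun y => cdot n0 (ik d K p) (Falpha d K a fh (sh1 u n) (sh1 du n) (sh2 u n) (sh2 du n) p y)
              + F0 d n0 K a fh (sh1 u n) (sh2 u n) (sh2 du n) p y)%C
    a (knorm d n0 K p) (tau d n0 K a h p) T (INR n0 * T) T Ha Hk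
    (tau_bounds d n0 K a h p Hh) HT ltac:(now apply Rmult_le_pos) HT Hd) as HB.
  lapply HB; [clear HB; intros HB|].
  2: { intros y Hy; destruct (Heq y Hy) as [u2 [l [E1 [E2 E3]]]]; exists u2, l.
       split; [auto|split; [auto|]]. rewrite knorm_sq, E3. ring. }
  lapply HB; [clear HB; intros HB|].
  2: { intros y Hy. apply (Cmod_Fy_le d n0 K a s fh Ha Hs phi mf Hphi Hf0 Hf1 _ (sh1 du n) _ _
         M1 M2 m1 m2 HU1 HU2 HM1 HM2 p y Hp); lra. }
  lapply HB; [clear HB; intros HB|].
  2: { intros y Hy. eapply Rle_trans; [apply Cmod_triangle|]. apply Rplus_le_compat.
       - replace (knorm d n0 K p * (INR n0 * T)) with (INR n0 * (knorm d n0 K p * T)) by ring.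
         apply Cmod_cdot_le; auto; intros j Hj; [now apply Cmod_ik_le|].
         apply (Cmod_Falpha_le d n0 K a s fh Ha Hs phi mf Hphi Hf0 Hf1 _ _ _ _
           M1 M2 m1 m2 HU1 HU2 HM1 HM2 p y Hp); auto; lra.
       - apply (Cmod_F0_le d n0 K a s fh Ha Hs phi mf Hphi Hf0 Hf1 _ (sh1 du n) _ _
           M1 M2 m1 m2 HU1 HU2 HM1 HM2 p y Hp); lra. }
  simpl in HB. rewrite HJ in HB.
  pose proof (Cmod_Jn_le d n0 K a h s fh Ha Hh Hs phi mf Hphi Hf0 _ _ M1 M2 m1 m2 HU1 HM1 HM2 p Hp) as HJn.
  fold T in HJn.
  assert (Hdir : knorm d n0 K p * Cmod (u n p 0) = dirichlet n p).
  { rewrite H0; unfold dirichlet; destruct n; auto. rewrite Cmod_0; ring. }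
  rewrite Hdir in HB.
  assert (Hdir0 : 0 <= dirichlet n p).
  { rewrite <- Hdir; apply Rmult_le_pos; [auto|apply Cmod_ge_0]. }
  assert (Hfin : 10 * (dirichlet n p + Cmod (Jn d n0 K a h fh (sh1 u n) p)
                   + (a * T + INR n0 * T + a * T)) <= next_major M1 M2 n p).
  { apply Rle_trans with (10 * dirichlet n p + 10 * (1 + 2 * a + INR n0) * T); [lra|].
    destruct (step_const_bounds n0 a Ha) as [Hsc _].
    unfold next_major.
    set (W := conv d phi M1 p + conv d (conv d phi phi) M2 p) in *.
    apply Rle_trans with ((10 + 10 * (1 + 2 * a + INR n0) * source_const n0 a)
                          * (dirichlet n p + W)).
    - unfold T. assert (0 <= 10 * (1 + 2 * a + INR n0) * source_const n0 a) by (apply Rmult_le_pos; lra).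
      assert (0 <= W) by (unfold W; lra).
      assert (0 <= 10 * (1 + 2 * a + INR n0) * source_const n0 a * dirichlet n p) by now apply Rmult_le_pos.
      lra.
    - replace (dirichlet n p + conv d phi M1 p + conv d (conv d phi phi) M2 p)
        with (dirichlet n p + W) by (unfold W; ring).
      apply Rmult_le_compat_r; auto. unfold W; lra. }
  intros y Hy. destruct (HB y Hy) as [B1 B2]. split; lra.
Qed.

(** [M p] pays for [du] at [y = 0]; the remaining terms are lattice sums already estimated, taken at
    [y = 0], together with the convolution of [f] and the previous [G]. *)
Lemma Cmod_Gstep_le n M1 M2 m1 m2 M Gp g1 p :
  majorizes d n0 K a (sh1 u n) (sh1 du n) M1 -> majorizes d n0 K a (sh2 u n) (sh2 du n) M2 ->
  majorizes d n0 K a (u n) (du n) M ->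
  l2w d s M1 m1 -> l2w d s M2 m2 -> l2w d s (fun q => Cmod (Gp q)) g1 -> length p = d ->
  Cmod (Gstep d n0 K a fh u du n Gp p) <= M p + step_const n0 a *
    (conv d phi M1 p + conv d phi (fun q => Cmod (Gp q)) p + conv d (conv d phi phi) M2 p).
Proof.
  intros HU1 HU2 HU HM1 HM2 HG Hp.
  assert (Hy0 : - a <= 0 <= 0) by lra.
  pose proof (proj2 (HU p Hp 0 Hy0)) as B0.
  pose proof (zsum_gradf_gradu_le d n0 K a s fh Hs phi mf Hphi Hf1 _ _ M1 m1 HU1 HM1 p 0 Hp Hy0) as B1.
  pose proof (zsum_fgradf_gradu_le d n0 K a s fh Hs phi mf Hphi Hf0 Hf1 _ _ M2 m2 HU2 HM2 p 0 Hp Hy0) as B3.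
  pose proof (zsum_gradf2_du_le d n0 K a s fh Hs phi mf Hphi Hf1 _ _ M2 m2 HU2 HM2 p 0 Hp Hy0) as B4.
  assert (B2 : Cmod (zsum d (fun q => fh (zsub p q) * Gp q)%C)
               <= 2 * (1 * conv d phi (fun q => Cmod (Gp q)) p)).
  { apply (Cmod_zsum_conv_le d s phi _ mf g1); auto using Rle_0_1. intros q Hq.
    rewrite Cmod_mult, Rmult_1_l. apply Rmult_le_compat_r; [apply Cmod_ge_0|auto]. }
  unfold Gstep.
  set (z1 := zsum d (fun q => cdot n0 (ik d K (zsub p q)) (ik d K q) * fh (zsub p q) * sh1 u n q 0)%C) in *.
  set (z2 := zsum d (fun q => fh (zsub p q) * Gp q)%C) in *.
  set (z3 := zsum d (fun q => cdot n0 (fgradf d K fh (zsub p q)) (ik d K q) * sh2 u n q 0)%C) in *.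
  set (z4 := zsum d (fun q => gradf2 d n0 K fh (zsub p q) * sh2 du n q 0)%C) in *.
  pose proof (conv_phi_nonneg d s Hs phi mf Hphi M1 m1 HM1 p Hp) as HN1.
  pose proof (conv_phi_nonneg d s Hs phi mf Hphi _ g1 HG p Hp) as HNG.
  pose proof (conv_ff_nonneg d s Hs phi mf Hphi M2 m2 HM2 p Hp) as HN2.
  set (N1 := conv d phi M1 p) in *. set (N2 := conv d (conv d phi phi) M2 p) in *.
  set (NG := conv d phi (fun q => Cmod (Gp q)) p) in *.
  assert (Hia : 0 < / a) by now apply Rinv_0_lt_compat.
  assert (Hmul : forall z, Cmod (RtoC (/ a) * z)%C = / a * Cmod z).
  { intros z; rewrite Cmod_mult, Cmod_RtoC_pos; lra. }
  unfold Cminus.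
  eapply Rle_trans; [apply Cmod_triangle|].
  eapply Rle_trans; [apply Rplus_le_compat_r, Cmod_triangle|].
  eapply Rle_trans; [do 2 apply Rplus_le_compat_r; apply Cmod_triangle|].
  eapply Rle_trans; [do 3 apply Rplus_le_compat_r; apply Cmod_triangle|].
  rewrite !Cmod_opp, !Hmul.
  assert (/ a * Cmod z2 <= / a * (2 * (1 * NG))) by (apply Rmult_le_compat_l; lra).
  assert (/ a * Cmod z3 <= / a * (2 * (2 * INR n0 * N2))) by (apply Rmult_le_compat_l; lra).
  destruct (step_const_bounds n0 a Ha) as [_ Hsc].
  assert (4 * (1 + INR n0) * (1 + / a) * (N1 + NG + N2) <= step_const n0 a * (N1 + NG + N2)).
  { apply Rmult_le_compat_r; lra. }
  pose proof (pos_INR n0) as Hn.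
  assert (0 <= / a * N1) by (apply Rmult_le_pos; lra).
  assert (0 <= / a * N2) by (apply Rmult_le_pos; lra).
  assert (0 <= / a * NG) by (apply Rmult_le_pos; lra).
  assert (0 <= INR n0 * N1) by (apply Rmult_le_pos; lra).
  assert (0 <= INR n0 * N2) by (apply Rmult_le_pos; lra).
  assert (0 <= INR n0 * NG) by (apply Rmult_le_pos; lra).
  assert (0 <= INR n0 * (/ a * N1)) by (apply Rmult_le_pos; lra).
  assert (0 <= INR n0 * (/ a * N2)) by (apply Rmult_le_pos; lra).
  assert (0 <= INR n0 * (/ a * NG)) by (apply Rmult_le_pos; lra).
  lra.
Qed.

Context (mx : R) (Hxi : l2w d s (fun p => knorm d n0 K p * Cmod (xih p)) mx).

Definition dirichlet_norm (n : nat) : R := match n with O => mx | S _ => 0 end.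

Lemma l2w_dirichlet n : l2w d s (dirichlet n) (dirichlet_norm n).
Proof. destruct n; [exact Hxi|apply l2w_zero]. Qed.

Context (B : R) (HB0 : 0 < B) (HB : 4 * (step_const n0 a * (conv_const d s * mf)) <= B).

Let c := step_const n0 a.
Let t := conv_const d s * mf.

Lemma conv_factor_nonneg : 0 <= t.
Proof.
  pose proof (conv_sq_const_nonneg d s). apply Rmult_le_pos; [unfold conv_const; lra|apply Hphi].
Qed.

Lemma step_conv_le m : 0 <= m -> c * (t * m) <= B * m / 4.
Proof. intros Hm. fold c t in HB. nra. Qed.

(** Two factors [t] come with only one [c]; [c >= 1] supplies the second, so that
    [c t^2 <= (c t)^2 <= (B / 4)^2]. *)
Lemma step_conv_conv_le m : 0 <= m -> c * (t * (t * m)) <= B * (B * m) / 16.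
Proof.
  intros Hm. pose proof conv_factor_nonneg as Ht. pose proof (step_const_ge1 n0 a Ha) as Hc; fold c in Hc.
  pose proof (step_conv_le m Hm) as H1.
  assert (H0 : 0 <= t * m) by now apply Rmult_le_pos.
  pose proof (step_conv_le (t * m) H0) as H2.
  assert (t * m <= c * (t * m)) by nra. nra.
Qed.

(** [Y] is the bound sought at index [n]. For [G] the contributions are at most [Y] from [du],
    [Y / 4] and [Y / 16] from the earlier [u], and [B g1 / 4 <= Y] from the previous [G]; their sum
    stays below [4 Y], so the factor [4] reproduces itself. *)
Lemma step_bound n M1 M2 m1 m2 Gp g1 Y :
  majorizes d n0 K a (sh1 u n) (sh1 du n) M1 -> majorizes d n0 K a (sh2 u n) (sh2 du n) M2 ->
  l2w d s M1 m1 -> l2w d s M2 m2 -> l2w d s (fun q => Cmod (Gp q)) g1 ->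
  c * dirichlet_norm n + B * m1 / 4 + B * (B * m2) / 16 <= Y ->
  B * m1 <= Y -> B * (B * m2) <= Y -> B * g1 <= 4 * Y ->
  exists M, majorizes d n0 K a (u n) (du n) M /\ l2w d s M Y /\
    l2w d s (fun p => Cmod (Gstep d n0 K a fh u du n Gp p)) (4 * Y).
Proof.
  intros HU1 HU2 HM1 HM2 HG HY1 HY2 HY3 HY4.
  pose proof (step_const_ge1 n0 a Ha) as Hc; fold c in Hc.
  pose proof (l2w_conv d s phi M1 mf m1 Hs Hphi HM1) as L1.
  pose proof (l2w_conv d s phi _ mf g1 Hs Hphi HG) as LG.
  pose proof (l2w_conv d s _ M2 _ m2 Hs (l2w_ff d s Hs phi mf Hphi) HM2) as L2.
  pose proof (step_conv_le m1 (proj1 HM1)) as C1. pose proof (step_conv_le g1 (proj1 HG)) as CG.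
  pose proof (step_conv_conv_le m2 (proj1 HM2)) as C2.
  pose proof (majorizes_next n M1 M2 m1 m2 HU1 HU2 HM1 HM2) as HU.
  assert (LM : l2w d s (next_major M1 M2 n) Y).
  { eapply l2w_le.
    - apply (l2w_scal d s c); [lra|].
      apply l2w_plus; [apply l2w_plus; [apply (l2w_dirichlet n)|exact L1]|exact L2].
    - unfold t in *. lra.
    - intros p Hp; unfold next_major; fold c; split; [|lra].
      apply Rmult_le_pos; [lra|].
      pose proof (proj1 (proj2 (l2w_dirichlet n)) p Hp).
      pose proof (proj1 (proj2 L1) p Hp). pose proof (proj1 (proj2 L2) p Hp). simpl in *; lra. }
  exists (next_major M1 M2 n); split; [exact HU|split; [exact LM|]].
  eapply l2w_le.
  - apply l2w_plus; [exact LM|]. apply (l2w_scal d s c); [lra|].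
    apply l2w_plus; [apply l2w_plus; [exact L1|exact LG]|exact L2].
  - pose proof (proj1 LM). unfold t in *. lra.
  - intros p Hp; split; [apply Cmod_ge_0|].
    apply (Cmod_Gstep_le n M1 M2 m1 m2 _ Gp g1 p); auto.
Qed.

Lemma majorizes_zero : majorizes d n0 K a zeroU zeroU (fun _ => 0).
Proof. intros q _ y _; unfold zeroU; rewrite Cmod_0; lra. Qed.

Lemma recursion_bound n : exists M, majorizes d n0 K a (u n) (du n) M /\
  l2w d s M (c * mx * B ^ n) /\
  l2w d s (fun p => Cmod (Gn d n0 K a fh u du n p)) (4 * (c * mx * B ^ n)).
Proof.
  pose proof (step_const_ge1 n0 a Ha) as Hc; fold c in Hc.
  assert (Hmx : 0 <= c * mx) by (apply Rmult_le_pos; [lra|apply Hxi]).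
  assert (HBn : forall k, 0 <= c * mx * B ^ k) by (intros k; apply Rmult_le_pos; [auto|apply pow_le; lra]).
  assert (HBS : forall k, B * (c * mx * B ^ k) = c * mx * B ^ S k) by (intros; simpl; ring).
  induction n as [n IH] using lt_wf_ind.
  (* The indices [0] and [1] are separate because zero functions replace the missing predecessors.
     At [0] the Dirichlet term equals [Y = c mx] exactly; from [1] on it vanishes and
     [1/4 + 1/16 <= 1] closes the step. *)
  destruct n as [|[|n]].
  - apply (step_bound 0 (fun _ => 0) (fun _ => 0) 0 0 (fun _ => RtoC 0) 0);
      try apply majorizes_zero; try apply l2w_zero; simpl; try lra.
    apply l2w_le with (fun _ => 0) 0; [apply l2w_zero|lra|].
    intros; rewrite Cmod_0; lra.
  - destruct (IH 0%nat ltac:(lia)) as [M1 [HU1 [HM1 HG1]]].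
    pose proof (HBn 1%nat) as HY.
    apply (step_bound 1 M1 (fun _ => 0) (c * mx * B ^ 0) 0 (Gn d n0 K a fh u du 0) (4 * (c * mx * B ^ 0)));
      try exact majorizes_zero; try apply l2w_zero; auto;
      unfold dirichlet_norm; pose proof (HBS 0%nat); lra.
  - destruct (IH (S n) ltac:(lia)) as [M1 [HU1 [HM1 HG1]]].
    destruct (IH n ltac:(lia)) as [M2 [HU2 [HM2 _]]].
    pose proof (HBn (S (S n))) as HY. pose proof (HBS n) as E1; pose proof (HBS (S n)) as E2.
    apply (step_bound (S (S n)) M1 M2 (c * mx * B ^ S n) (c * mx * B ^ n) (Gn d n0 K a fh u du (S n))
      (4 * (c * mx * B ^ S n))); auto; unfold dirichlet_norm; rewrite ?E1; lra.
Qed.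

End Recursion.

(** * Power series in the weighted space *)

Lemma csum_S n f : csum (S n) f = (csum n f + f n)%C.
Proof.
  unfold csum. rewrite seq_S, map_app, fold_right_app. simpl.
  assert (E : forall (l : list C) (z w : C),
    fold_right Cplus (z + w)%C l = (fold_right Cplus w l + z)%C).
  { induction l as [|x l IH]; intros z w; simpl; [ring|rewrite IH; ring]. }
  apply (E _ (f n) (RtoC 0)).
Qed.

Lemma Cmod_sq (z : C) : Cmod z ^ 2 = fst z ^ 2 + snd z ^ 2.
Proof. unfold Cmod; apply pow2_sqrt. pose proof (pow2_ge_0 (fst z)); pose proof (pow2_ge_0 (snd z)); lra. Qed.

Section PowerSeries.
Context (d s : nat) (G : nat -> list Z -> C) (A B eps : R).
Context (HB : 0 < B) (Heps : Rabs eps < / B).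
Context (HG : forall n, l2w d s (fun p => Cmod (G n p)) (A * B ^ n)).

Let rho := Rabs eps * B.
Let P (N : nat) (p : list Z) : C := csum (S N) (fun n => (RtoC (eps ^ n) * G n p)%C).
(** The geometric remainder: the sum of [A rho^n] over [n > N]. *)
Let tail (N : nat) : R := A * rho ^ S N / (1 - rho).

Lemma ratio_bounds : 0 <= rho < 1.
Proof.
  unfold rho; split; [apply Rmult_le_pos; [apply Rabs_pos|lra]|].
  apply (Rmult_lt_compat_r B) in Heps; auto. rewrite Rinv_l in Heps; lra.
Qed.

Lemma geometric_scale_nonneg : 0 <= A.
Proof. pose proof (proj1 (HG 0)) as H; simpl in H; lra. Qed.

Lemma tail_nonneg N : 0 <= tail N.
Proof.
  pose proof ratio_bounds; pose proof geometric_scale_nonneg. unfold tail.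
  apply Rmult_le_pos; [|left; apply Rinv_0_lt_compat; lra].
  apply Rmult_le_pos; [auto|apply pow_le; lra].
Qed.

(** The factor [1 - rho^k] makes the bound the exact finite geometric sum from [N + 1] to [N + k],
    which lets the induction on [k] close with equality. *)
Lemma l2w_partial_diff N k :
  l2w d s (fun p => Cmod (P (N + k) p - P N p)%C) (tail N * (1 - rho ^ k)).
Proof.
  pose proof ratio_bounds as Hr. pose proof geometric_scale_nonneg as HA.
  induction k as [|k IH].
  - eapply l2w_le; [apply (l2w_zero d s)|simpl; lra|].
    intros p _. rewrite Nat.add_0_r. replace (P N p - P N p)%C with (RtoC 0) by ring.
    rewrite Cmod_0; lra.
  - eapply l2w_le.
    + apply l2w_plus; [exact IH|].
      apply (l2w_scal d s (Rabs eps ^ (S (N + k))) _ _ (pow_le _ _ (Rabs_pos eps)) (HG (S (N + k)))).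
    + right.
      replace (Rabs eps ^ S (N + k) * (A * B ^ S (N + k))) with (A * rho ^ S (N + k))
        by (unfold rho; rewrite Rpow_mult_distr; ring).
      unfold tail. replace (S (N + k)) with (S N + k)%nat by lia.
      rewrite pow_add. simpl (rho ^ S k). field; lra.
    + intros p Hp; split; [apply Cmod_ge_0|].
      replace (N + S k)%nat with (S (N + k)) by lia.
      assert (E : P (S (N + k)) p = (P (N + k) p + RtoC (eps ^ S (N + k)) * G (S (N + k)) p)%C)
        by apply csum_S.
      rewrite E.
      replace (P (N + k) p + RtoC (eps ^ S (N + k)) * G (S (N + k)) p - P N p)%C
        with ((P (N + k) p - P N p) + RtoC (eps ^ S (N + k)) * G (S (N + k)) p)%C by ring.
      eapply Rle_trans; [apply Cmod_triangle|]. rewrite Cmod_mult, Cmod_R, <- RPow_abs. lra.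
Qed.

Lemma Cmod_partial_diff_le N n p : (N <= n)%nat -> length p = d ->
  Cmod (P n p - P N p)%C <= tail N.
Proof.
  intros Hn Hp. replace n with (N + (n - N))%nat by lia.
  eapply Rle_trans; [apply (l2w_pointwise d s _ _ p (l2w_partial_diff N (n - N)) Hp)|].
  pose proof (tail_nonneg N). pose proof ratio_bounds.
  assert (0 <= rho ^ (n - N)) by (apply pow_le; lra). nra.
Qed.

Lemma tail_lim : is_lim_seq tail 0.
Proof.
  pose proof ratio_bounds.
  apply is_lim_seq_ext with (fun N => A * rho / (1 - rho) * rho ^ N).
  { intros N; unfold tail; simpl; field; lra. }
  replace 0 with (A * rho / (1 - rho) * 0) by ring.
  apply (is_lim_seq_scal_l _ _ (Finite 0)). apply is_lim_seq_geom. rewrite Rabs_pos_eq; lra.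
Qed.

(** Each Fourier coefficient of the partial sums is Cauchy, because weights at least [1] make the
    weighted norm dominate it. [pr] stands for the real or the imaginary part. *)
Lemma ex_lim_component (pr : C -> R) p :
  (forall z w, Rabs (pr z - pr w) <= Cmod (z - w)%C) -> length p = d ->
  ex_finite_lim_seq (fun n => pr (P n p)).
Proof.
  intros Hpr Hp. apply ex_lim_seq_cauchy_corr. intros e.
  destruct (proj2 (is_lim_seq_spec _ _) tail_lim (pos_div_2 e)) as [N HN].
  specialize (HN N (Nat.le_refl N)). simpl in HN.
  pose proof (tail_nonneg N). rewrite Rminus_0_r, Rabs_pos_eq in HN by auto.
  exists N; intros n m Hn Hm.
  pose proof (Cmod_partial_diff_le N n p Hn Hp) as H1.
  pose proof (Cmod_partial_diff_le N m p Hm Hp) as H2.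
  pose proof (Hpr (P n p) (P N p)) as H3. pose proof (Hpr (P N p) (P m p)) as H4.
  rewrite <- Cmod_opp in H2. replace (- (P m p - P N p))%C with (P N p - P m p)%C in H2 by ring.
  replace (pr (P n p) - pr (P m p)) with ((pr (P n p) - pr (P N p)) + (pr (P N p) - pr (P m p))) by ring.
  eapply Rle_lt_trans; [apply Rabs_triang|]. lra.
Qed.

Let Slim (p : list Z) : C :=
  (real (Lim_seq (fun n => fst (P n p))), real (Lim_seq (fun n => snd (P n p)))).

(** A Fatou argument: on a fixed finite box the coefficientwise limit may be taken in the uniform
    bound for [P (N + k) - P N], and the box is arbitrary. *)
Lemma l2w_limit_diff N : l2w d s (fun p => Cmod (Slim p - P N p)%C) (tail N).
Proof.
  split; [apply tail_nonneg|split; [intros; apply Cmod_ge_0|]]. intros M.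
  assert (L : is_lim_seq (fun k => lsum (box d M) (fun p => (1 + zsq p) ^ s
      * Cmod (P (k + N)%nat p - P N p)%C ^ 2))
      (lsum (box d M) (fun p => (1 + zsq p) ^ s * Cmod (Slim p - P N p)%C ^ 2))).
  { apply is_lim_seq_lsum; intros p Hp; apply box_length in Hp.
    assert (L1 : is_lim_seq (fun k => fst (P (k + N)%nat p)) (fst (Slim p))).
    { apply (is_lim_seq_incr_n (fun n => fst (P n p))). apply Lim_seq_correct'.
      apply ex_lim_component; auto. intros z w; apply (Rabs_fst_le (z - w)%C). }
    assert (L2 : is_lim_seq (fun k => snd (P (k + N)%nat p)) (snd (Slim p))).
    { apply (is_lim_seq_incr_n (fun n => snd (P n p))). apply Lim_seq_correct'.
      apply ex_lim_component; auto. intros z w; apply (Rabs_snd_le (z - w)%C). }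
    apply (is_lim_seq_scal_l _ _ (Finite _)).
    rewrite Cmod_sq.
    apply is_lim_seq_ext with (fun k =>
      (fst (P (k + N)%nat p) - fst (P N p)) * (fst (P (k + N)%nat p) - fst (P N p))
      + (snd (P (k + N)%nat p) - snd (P N p)) * (snd (P (k + N)%nat p) - snd (P N p))).
    { intros k; rewrite Cmod_sq; simpl; ring. }
    replace (fst (Slim p - P N p)%C ^ 2 + snd (Slim p - P N p)%C ^ 2) with
      ((fst (Slim p) - fst (P N p)) * (fst (Slim p) - fst (P N p))
       + (snd (Slim p) - snd (P N p)) * (snd (Slim p) - snd (P N p))) by (simpl; ring).
    apply is_lim_seq_plus'; apply is_lim_seq_mult'; apply is_lim_seq_minus'; auto;
      apply is_lim_seq_const. }
  refine (is_lim_seq_le _ (fun _ => tail N ^ 2) _ _ _ L (is_lim_seq_const _)).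
  intros k. rewrite Nat.add_comm.
  eapply Rle_trans; [apply (l2w_partial_diff N k)|].
  pose proof (tail_nonneg N). pose proof ratio_bounds.
  assert (0 <= rho ^ k <= 1).
  { split; [apply pow_le; lra|]. rewrite <- (pow1 k). apply pow_incr; lra. }
  apply pow_incr; split; [apply Rmult_le_pos; lra|nra].
Qed.

Lemma power_series_converges : exists S : list Z -> C,
  in_Hs d (INR s) S /\
  (forall N, in_Hs d (INR s) (fun p => (S p - P N p)%C)) /\
  is_lim_seq (fun N => Hs_norm d (INR s) (fun p => (S p - P N p)%C)) 0.
Proof.
  exists Slim; split; [|split].
  (* The limit is split as [(Slim - P 0) + P 0], where [P 0 = G 0]. *)
  - apply (in_Hs_of_l2w d s Slim (tail 0 + A * B ^ 0)).
    eapply l2w_le; [apply l2w_plus; [apply (l2w_limit_diff 0)|apply (HG 0)]|lra|].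
    intros p Hp; split; [apply Cmod_ge_0|].
    assert (E : P 0 p = G 0%nat p) by (unfold P, csum; simpl; ring).
    rewrite <- E. replace (Slim p) with ((Slim p - P 0 p) + P 0 p)%C at 1 by ring.
    apply Cmod_triangle.
  - intros N; apply (in_Hs_of_l2w d s _ _ (l2w_limit_diff N)).
  - apply is_lim_seq_le_le with (fun _ => 0) tail.
    + intros N; split; [apply sqrt_pos|apply (in_Hs_of_l2w d s _ _ (l2w_limit_diff N))].
    + apply is_lim_seq_const.
    + apply tail_lim.
Qed.

End PowerSeries.

(** * Geometric growth of the terms [G_n] and convergence of their series *)

Theorem theorem4p13 (d n0 : nat) (K : nat -> nat -> R) (a : R) (h : Rbar) (s : nat) :
  (1 <= n0)%nat -> (n0 < d)%nat -> Zindep d n0 K ->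
  0 < a -> Rbar_lt (Finite a) h -> (d < 2 * s)%nat ->
  exists C0 C1 : R, 0 < C0 /\ 0 < C1 /\
  forall (fh xih : list Z -> C) (u du : nat -> list Z -> R -> C),
    real_coeffs d fh ->
    in_Hs d (INR s + 3 / 2) fh ->
    in_Hs d (INR s + 1) xih ->
    solves_rec d n0 K a h fh xih u du ->
    forall B : R, C0 * Hs_norm d (INR s + 3 / 2) fh < B ->
      (forall n : nat,
         in_Hs d (INR s) (Gn d n0 K a fh u du n) /\
         Hs_norm d (INR s) (Gn d n0 K a fh u du n)
           <= (C1 * Hs_norm d (INR s + 1) xih) * B ^ n) /\
      (forall eps : R, Rabs eps < / B ->
         exists S : list Z -> C,
           in_Hs d (INR s) S /\
           (forall N : nat,
              in_Hs d (INR s) (fun p => (S p - Gpsum d n0 K a fh u du eps N p)%C)) /\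
           is_lim_seq
             (fun N => Hs_norm d (INR s) (fun p => (S p - Gpsum d n0 K a fh u du eps N p)%C))
             0).
Proof.
  intros _ _ _ Ha Hh Hs.
  pose proof (step_const_ge1 n0 a Ha) as Hc. pose proof (ksize_ge1 d n0 K) as Hk.
  assert (HCa : 1 <= conv_const d s).
  { pose proof (conv_sq_const_nonneg d s); unfold conv_const; lra. }
  (* The first constant turns [C0 * |f| < B] into the condition [4 c t <= B] of the recursion, where
     [t] contains the norm [ksize * |f|] of [phi]. In the second, [4] is the factor of the bound on
     [G] and [ksize] comes from replacing [k |xi|] by the [H^(s+1)] norm. *)
  exists (4 * (step_const n0 a * (conv_const d s * ksize d n0 K))), (4 * (step_const n0 a * ksize d n0 K)).
  split; [repeat apply Rmult_lt_0_compat; lra|].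
  split; [repeat apply Rmult_lt_0_compat; lra|].
  intros fh xih u du _ Hf Hxi Hsol B HB.
  set (phi := fun p => ksize d n0 K * sqrt (1 + zsq p) * Cmod (fh p)).
  assert (Hphi : l2w d s phi (ksize d n0 K * Hs_norm d (INR s + 3 / 2) fh)).
  { apply l2w_of_in_Hs; auto; lra. }
  assert (Hf1 : forall p, knorm d n0 K p * Cmod (fh p) <= phi p).
  { intros p; apply Rmult_le_compat_r; [apply Cmod_ge_0|apply knorm_le]. }
  assert (Hf0 : forall p, Cmod (fh p) <= phi p).
  { intros p; unfold phi. rewrite <- (Rmult_1_l (Cmod (fh p))) at 1.
    apply Rmult_le_compat_r; [apply Cmod_ge_0|].
    assert (1 <= sqrt (1 + zsq p)).
    { rewrite <- sqrt_1 at 1. apply sqrt_le_1_alt. pose proof (zsq_nonneg p); lra. }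
    nra. }
  assert (HX : l2w d s (fun p => knorm d n0 K p * Cmod (xih p)) (ksize d n0 K * Hs_norm d (INR s + 1) xih)).
  { eapply l2w_le; [apply (l2w_of_in_Hs d s (INR s + 1) xih (ksize d n0 K)); auto; lra|lra|].
    intros p _; split.
    - apply Rmult_le_pos; [apply knorm_nonneg|apply Cmod_ge_0].
    - apply Rmult_le_compat_r; [apply Cmod_ge_0|apply knorm_le]. }
  (* The norm of [f] may vanish, so positivity of [B] rests on the strict inequality. *)
  assert (HB0 : 0 < B).
  { eapply Rle_lt_trans; [|exact HB].
    apply Rmult_le_pos; [left; repeat apply Rmult_lt_0_compat; lra|apply sqrt_pos]. }
  assert (HG : forall n, l2w d s (fun p => Cmod (Gn d n0 K a fh u du n p))
     (4 * (step_const n0 a * ksize d n0 K) * Hs_norm d (INR s + 1) xih * B ^ n)).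
  { intros n. destruct (recursion_bound d n0 K a h s fh xih u du Ha Hh Hs Hsol phi _ Hphi Hf0 Hf1
      _ HX B HB0 ltac:(lra) n) as [M [_ [_ H]]].
    replace (4 * (step_const n0 a * ksize d n0 K) * Hs_norm d (INR s + 1) xih * B ^ n)
      with (4 * (step_const n0 a * (ksize d n0 K * Hs_norm d (INR s + 1) xih) * B ^ n)) by ring.
    exact H. }
  split.
  - intros n. apply in_Hs_of_l2w, HG.
  - intros eps Heps.
    exact (power_series_converges d s _ _ B eps HB0 Heps HG).
Qed.
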